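(* Consider a generalized branching random walk (GBRW) with branching rules $\{p_{n,k}\}_{n\ge 0,k\ge 1}$ and displacement laws $\{G_{n,k}\}_{n\ge 0,k\ge 1}$, where $G_{n,k}$ is a distribution function on $\mathbb{R}^k$ all of whose one-dimensional marginals equal $g_{n,k}$. Assume: (B1') there exist positive real numbers $m_0,m_1$ such that $\inf_n\sum_{k=1}^{\infty}kp_{n,k}>m_0>1$ and $\sup_n\sum_{k=1}^{\infty}k^2p_{n,k}<m_1$; (MT0') $g_{n,k}=g_n$ for all $k\ge 1$ (the marginals do not depend on $k$); put $\bar g_n=1-g_n$; (MT1') for some fixed $\epsilon_0<\min\{\frac14\log m_0,\,1\}$ there exists $x_0\in\mathbb{R}$ such that $\bar g_n(x_0)\ge 1-\epsilon_0$ for all $n$; (MT2') there exist $a>0$ and $M_0>0$ such that $\bar g_n(x+M)\le e^{-aM}\bar g_n(x)$ for all $n$, all $M>M_0$ and all $x\ge 0$; (GT') for every $\eta_1>0$ there exists $B>0$ such that $G_{n,k}(B,\dots,B)\ge 1-\eta_1$ and $\bar g_n(-B)\ge 1-\eta_1$ for all $n$ and $k$. Let $F_n$ be the distribution function of the maximal position $\mathcal{M}_n$ of the particles alive at time $n$, and $Med(F_n)$ the median of $F_n$. Then the family of recentered maxima distributions $\{F_n(\cdot-Med(F_n))\}_{n\ge 0}$ is tight, i.e. the laws of the random variables $\mathcal{M}_n-Med(F_n)$, $n\ge 0$, form a tight family.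
   Context: GBRW: the $p_{n,k}$ are nonnegative reals with $\sum_{k\ge1}p_{n,k}=1$ and $\sum_{k\ge 1}kp_{n,k}<\infty$ for each $n\ge 0$; the $G_{n,k}$ are distribution functions on $\mathbb{R}^k$. At time $0$ there is one particle at location $0$. A particle $v$ alive at time $n$ at location $S_v$ dies at time $n+1$ and gives birth to a random number $K_v\ge 1$ of offspring, located at $S_v+X_{v,1},\dots,S_v+X_{v,K_v}$. The random vectors $(K_v,X_{v,1},\dots,X_{v,K_v})$, indexed by all particles $v$, are independent, and for $v$ in generation $n$, conditionally on the locations of all particles up to time $n$, $P(K_v=k)=p_{n,k}$ and, given $K_v=k$, $(X_{v,1},\dots,X_{v,k})$ has joint distribution function $G_{n,k}$. $\mathbb{D}_n$ is the set of particles alive at time $n$ and $\mathcal{M}_n=\max_{v\in\mathbb{D}_n}S_v$. *)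

(* Defs.v *)
From HB Require Import structures.
From mathcomp Require Import all_boot all_order all_algebra.
From mathcomp Require Import all_classical all_reals all_analysis.

Set Implicit Arguments.
Unset Strict Implicit.
Unset Printing Implicit Defensive.
Import Order.TTheory GRing.Theory Num.Theory.
Import numFieldNormedType.Exports.

Local Open Scope classical_set_scope.
Local Open Scope ring_scope.

(* A distribution function on R^k is given through its law, a probability
   measure on k.-tuple R with the product sigma-algebra. *)
Definition joint_cdf (R : realType) (k : nat) (mu : probability (k.-tuple R) R)
    (x : k.-tuple R) : R :=
  fine (mu [set y | forall i : 'I_k, tnth y i <= tnth x i]).

Definition marginal_cdf (R : realType) (k : nat)
    (mu : probability (k.-tuple R) R) (i : 'I_k) (x : R) : R :=
  fine (mu [set y | tnth y i <= x]).

(* Mutual independence of the set systems (F i)_i, which are meant to be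
   sigma-algebras: product rule over every finite subfamily. *)
Definition mutually_independent d (T : measurableType d) (R : realType)
    (P : probability T R) (I : eqType) (F : I -> set (set T)) : Prop :=
  forall (s : seq I) (A : I -> set T), uniq s ->
    (forall i, i \in s -> F i (A i)) ->
    P [set w | forall i, i \in s -> A i w] = (\prod_(i <- s) P (A i))%E.

Definition branching_rules (R : realType) (p : nat -> nat -> R) : Prop :=
  forall n,
    [/\ forall k, (0 < k)%N -> 0 <= p n k,
        (\sum_(1 <= k <oo) (p n k)%:E = 1%:E)%E
      & (\sum_(1 <= k <oo) (k%:R * p n k)%:E < +oo)%E ].

(* Particles carry Ulam-Harris labels: the root is [::] and the children of v
   are rcons v 0, ..., rcons v (K_v - 1). Thus the generation of v is size v,
   and X v i below is the displacement X_{v,i+1}. *)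
Section process.
Context d (Omega : measurableType d) (R : realType) (P : probability Omega R).
Variables (K : seq nat -> {RV P >-> nat}) (X : seq nat -> nat -> {RV P >-> R}).

(* The sigma-algebra generated by (K_v, X_{v,1}, ..., X_{v,K_v}): the values of
   X v i off the event i < K_v are not part of the vector. *)
Definition offspring_sigma_algebra (v : seq nat) : set (set Omega) :=
  <<s [set A | (exists k, A = [set w | K v w = k]) \/
        (exists (k i : nat) (B : set R), [/\ (i < k)%N, measurable B &
           A = [set w | K v w = k /\ B (X v i w)]]) ] >>.

(* The vectors are independent over all labels, born or not, so their
   conditional laws given the past are their unconditional laws. *)
Record is_gbrw (p : nat -> nat -> R)
    (G : nat -> forall k, probability (k.-tuple R) R) : Prop := IsGBRW {
  gbrw_rules : branching_rules p ;
  gbrw_offspring_gt0 : forall v w, (0 < K v w)%N ;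
  gbrw_offspring_law : forall v k, (0 < k)%N ->
    P [set w | K v w = k] = (p (size v) k)%:E ;
  gbrw_displacement_law : forall v k (x : k.-tuple R), (0 < k)%N ->
    P [set w | K v w = k /\ forall i : 'I_k, X v i w <= tnth x i] =
    (P [set w | K v w = k] * (joint_cdf (G (size v) k) x)%:E)%E ;
  gbrw_independent : mutually_independent P offspring_sigma_algebra }.

Definition alive (n : nat) (w : Omega) : set (seq nat) :=
  [set v | size v = n /\
     forall j, (j < n)%N -> (nth 0%N v j < K (take j v) w)%N].

Definition location (v : seq nat) (w : Omega) : R :=
  \sum_(j < size v) X (take j v) (nth 0%N v j) w.

(* The set alive n w is finite and nonempty, so the supremum is a maximum. *)
Definition max_position (n : nat) (w : Omega) : R :=
  sup [set location v w | v in alive n w].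

Definition max_cdf (n : nat) (x : R) : R :=
  fine (P [set w | max_position n w <= x]).

End process.

Definition median (R : realType) (F : R -> R) : R :=
  inf [set x | 2^-1 <= F x].

Definition tight (R : realType) (mu : nat -> set R -> \bar R) : Prop :=
  forall e : R, 0 < e ->
    exists C : set R, compact C /\ forall n, (mu n (~` C) <= e%:E)%E.

(* Main.v *)
Require Import Defs.
From HB Require Import structures.
From mathcomp Require Import all_boot all_order all_algebra.
From mathcomp Require Import all_classical all_reals all_analysis.
From mathcomp Require Import measurable_realfun lra ring zify.
Import Order.TTheory GRing.Theory Num.Theory.
Import numFieldNormedType.Exports.

(* For a particle of generation s let u(x) be the probability that the maximum
   of its descendants r + 1 generations later exceeds its position by more than
   x, and let v be the analogous tail for its children and r generations. Then
   u(x) = E[1 - prod_i (1 - v(x - X_i))], the product being over the children.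

   The core is the inequality u(x - M) >= (1 + e) u(x) - kap u(x)^2, for
   constants not depending on s and r, proved by induction on r. If it fails at
   x with u(x) = l, then u is nearly constant on [x - M, x] and, since m > 1
   children are born on average, v <= rho l on a long interval, with
   m rho^2 < 1; so the quadratic error is contracted, which leaves room for the
   nonlinearity of the recursion, an error of order l^2. Jumps leading to
   places where v > l are longer than M - B, hence exponentially unlikely:
   they are compared with jumps shorter by M, and what they lose is small in
   comparison with what the latter gain.

   Consequently u decays geometrically as soon as it is below some fixed level
   de. The growth of u from one generation to the next then spreads this over
   all levels: the level la is separated from the level 1 - la by a bounded
   distance, and tightness around the median follows. *)

(** The displacements within a family may depend on each other in any way; only their marginal is
    controlled. So every estimate on a family is first reduced, pointwise, to sums of functions of
    single displacements, possibly weighted by the family size, and one term for the first child.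
    These are the expressions that [branching_step] averages, using the mean [m], the second moment
    bound [m1], and Markov's inequality to discard families larger than [k0]. Products over two
    children become squares by Cauchy-Schwarz, and the second moment pays for the resulting factor
    [k].

    The laws vary with time, so a tail carries the generation [s] of its root and the number [r] of
    generations below it. Passing to the children turns [(s, r.+1)] into [(s.+1, r)], and all
    constants must be uniform in both indices.

    There is no circularity in the constants: [e] depends on [m0] only, [k0] on [m1], and [kap] on
    [e], [k0] and [m1]; the length [c] of a long jump comes afterwards, so large that the factor [q]
    gained by shortening it beats every constant built from the others. *)

Local Open Scope classical_set_scope.
Local Open Scope ring_scope.

(** * The nonlinearity of a branching step *)

Section at_least_one.
Context {R : realType}.
Implicit Types (k : nat) (a b w : nat -> R).

(* The probability that at least one of [k] independent events of
   probabilities [a 0, ..., a (k - 1)] occurs. *)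
Definition at_least_one k a : R := 1 - \prod_(i < k) (1 - a i).

Definition probs a := forall i, 0 <= a i <= 1.

Lemma prod_compl_bounds k a : probs a -> 0 <= \prod_(i < k) (1 - a i) <= 1.
Proof.
move=> a01; apply/andP; split.
  by apply: prodr_ge0 => i _; have /andP[] := a01 i; lra.
by apply: prodr_ile1 => i _; have /andP[] := a01 i; lra.
Qed.

Lemma at_least_one_bounds k a : probs a -> 0 <= at_least_one k a <= 1.
Proof. by move=> /(prod_compl_bounds k) /andP[]; rewrite /at_least_one; lra. Qed.

Lemma at_least_one_le k a b : probs a -> probs b -> (forall i, a i <= b i) ->
  at_least_one k a <= at_least_one k b.
Proof.
move=> a01 b01 ab; rewrite lerD2l lerN2; apply: ler_prod => i _.
by have := ab i; have /andP[] := b01 i; lra.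
Qed.

Lemma at_least_one_le_sum k a : probs a -> at_least_one k a <= \sum_(i < k) a i.
Proof.
move=> a01; rewrite /at_least_one.
elim: k => [|k IH]; first by rewrite !big_ord0 subrr.
rewrite !big_ord_recr /=.
by have := prod_compl_bounds k a a01; have := a01 k; nra.
Qed.

(** Replace the factors one at a time: exchanging [a i] for [w i] gains [w i - a i] times the
    product of the other factors, which is at least one minus the sum of the [w i]. *)
Lemma at_least_one_diff_ge k a w : probs a -> probs w ->
    (forall i, a i <= w i) ->
  (\sum_(i < k) (w i - a i)) * (1 - \sum_(i < k) w i) <=
    at_least_one k w - at_least_one k a.
Proof.
move=> a01 w01 aw.
suff: (\sum_(i < k) (w i - a i)) * (1 - \sum_(i < k) w i) <=
    \prod_(i < k) (1 - a i) - \prod_(i < k) (1 - w i).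
  by rewrite /at_least_one; lra.
have mono j : \prod_(i < j) (1 - w i) <= \prod_(i < j) (1 - a i).
  by have := at_least_one_le j a w a01 w01 aw; rewrite /at_least_one; lra.
elim: k => [|k IH]; first by rewrite !big_ord0 mul0r subrr.
rewrite !big_ord_recr /=.
have wge : 1 - \sum_(i < k) w i <= \prod_(i < k) (1 - w i).
  by have := at_least_one_le_sum k w w01; rewrite /at_least_one; lra.
have D0 : 0 <= \sum_(i < k) (w i - a i).
  by apply: sumr_ge0 => i _; rewrite subr_ge0.
have W0 : 0 <= \sum_(i < k) w i.
  by apply: sumr_ge0 => i _; have /andP[] := w01 i.
have := mono k; have := prod_compl_bounds k w w01.
move: (aw k) (a01 k) (w01 k) IH wge D0 W0.
move: (\sum_(i < k) (w i - a i)) (\sum_(i < k) w i) => D W.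
move: (\prod_(i < k) (1 - a i)) (\prod_(i < k) (1 - w i)) => pa pw.
move: (a k) (w k) => x y xy /andP[x0 x1] /andP[y0 y1] IH wge D0 W0 /andP[p0 p1] papw.
(* When this factor is not positive the left-hand side is at most 0 and monotonicity suffices;
   otherwise the terms are compared one by one. *)
have [W1|W1] := leP (1 - W - y) 0.
  apply: (@le_trans _ _ 0); last by nra.
  by apply: mulr_ge0_le0; lra.
have h1 : D * (1 - W) * (1 - x) <= (pa - pw) * (1 - x).
  by apply: ler_wpM2r => //; lra.
have h2 : D * (1 - W - y) <= D * ((1 - W) * (1 - x)).
  by apply: ler_wpM2l => //; nra.
have h3 : (y - x) * (1 - W - y) <= (y - x) * pw.
  by apply: ler_wpM2l; lra.
by nra.
Qed.

(** Cauchy-Schwarz. It removes products over two different children, whose joint law is not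
    controlled. *)
Lemma sum_sqr_le k a : (\sum_(i < k) a i) ^+ 2 <= k%:R * \sum_(i < k) a i ^+ 2.
Proof.
have -> : (\sum_(i < k) a i) ^+ 2 = \sum_(i < k) \sum_(j < k) (a i * a j).
  by rewrite expr2 mulr_suml; apply: eq_bigr => i _; rewrite mulr_sumr.
have -> : k%:R * \sum_(i < k) a i ^+ 2 =
    \sum_(i < k) \sum_(j < k) (a i ^+ 2 / 2 + a j ^+ 2 / 2).
  set Q := \sum_(i < k) _ ^+ 2.
  under [RHS]eq_bigr => i _.
    rewrite big_split /= sumr_const card_ord -[_ *+ k]mulr_natl -mulr_suml -/Q.
    over.
  rewrite big_split /= sumr_const card_ord -[_ *+ k]mulr_natl -mulr_sumr.
  by rewrite -mulr_suml -/Q; lra.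
apply: ler_sum => i _; apply: ler_sum => j _.
by have := sqr_ge0 (a i - a j); nra.
Qed.

Lemma at_least_one_ge_sum k a : probs a ->
  \sum_(i < k) a i - k%:R * \sum_(i < k) a i ^+ 2 <= at_least_one k a.
Proof.
move=> a01; have p0 : probs (fun _ : nat => 0 : R) by move=> i; rewrite lexx ler01.
have := at_least_one_diff_ge k _ _ p0 a01 (fun i => proj1 (andP (a01 i))).
have -> : \sum_(i < k) (a i - 0) = \sum_(i < k) a i.
  by apply: eq_bigr => i _; rewrite subr0.
have -> : at_least_one k (fun=> 0) = 0.
  by rewrite /at_least_one big1 ?subrr // => i _; rewrite subr0.
by rewrite subr0; have := sum_sqr_le k a; nra.
Qed.

(** Only the gain at the first event is kept; it is weighted by the probability that no other event
    occurs, which a union bound controls. *)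
Lemma at_least_one_first_ge k b w : (0 < k)%N -> probs b -> probs w ->
    (forall i, w i <= b i) ->
  at_least_one k w + (b 0%N - w 0%N) * (1 - \sum_(i < k) w i) <=
  at_least_one k b.
Proof.
case: k => // k _ b01 w01 wb; rewrite /at_least_one !big_ord_recl /=.
set pb := \prod_(i < k) (1 - b _); set pw := \prod_(i < k) (1 - w _).
have pbw : pb <= pw.
  by apply: ler_prod => i _; have := wb (bump 0 i); have /andP[] := b01 (bump 0 i); lra.
have wS : probs (fun i => w (bump 0 i)) by move=> i; exact: w01.
have pw1 : 1 - \sum_(i < k) w (bump 0 i) <= pw.
  by have := at_least_one_le_sum k _ wS; rewrite /at_least_one -/pw; lra.
have pw0 := prod_compl_bounds k _ wS; rewrite -/pw in pw0.
set s := \sum_(i < k) _ in pw1 *.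
have := wb 0%N; have /andP[] := b01 0%N; have /andP[] := w01 0%N => w0 w1 b0 b1 le0.
have h : (b 0%N - w 0%N) * (1 - (w 0%N + s)) <= (b 0%N - w 0%N) * pw.
  by apply: ler_wpM2l; lra.
have h' : (1 - b 0%N) * pb <= (1 - b 0%N) * pw by apply: ler_wpM2l; lra.
by nra.
Qed.

End at_least_one.

Section flatness_loss.
Context {R : realType}.
Variables (e c : R) (e0 : 0 < e) (e2 : e <= 2^-1) (c0 : 0 < c).

(* What is lost, at level [t], by replacing the linear growth [(1 + e) * t] by
   [max t ((1 + e) * t - c * t ^+ 2)]. *)
Definition loss (t : R) := Num.min (e * t) (c * t ^+ 2).

Lemma loss_ge0 t : 0 <= t -> 0 <= loss t.
Proof. by move=> t0; rewrite /loss le_min !mulr_ge0 ?exprn_ge0 // ltW. Qed.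

Lemma loss_le_lin t : loss t <= e * t.
Proof. by rewrite /loss ge_min lexx. Qed.

Lemma loss_le_sqr t : loss t <= c * t ^+ 2.
Proof. by rewrite /loss ge_min lexx orbT. Qed.

Lemma loss_mono s t : 0 <= s -> s <= t -> loss s <= loss t.
Proof.
move=> s0 st; rewrite /loss le_min !ge_min ler_pM2l // st /=.
by rewrite ler_pM2l // lerXn2r ?nnegrE ?(le_trans s0) ?orbT.
Qed.

(** Lets the loss at a level below [2 * t] be charged to the loss at [t]; the factor 4 comes from
    the quadratic branch. *)
Lemma loss_double t : 0 <= t -> loss (2 * t) <= 4 * loss t.
Proof.
move=> t0; have et : 0 <= e * t by rewrite mulr_ge0 // ltW.
have ct : 0 <= c * t ^+ 2 by rewrite mulr_ge0 ?exprn_ge0 // ltW.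
rewrite /loss ge_min.
case: (leP (e * t) (c * t ^+ 2)) => _; apply/orP; [left|right]; first by lra.
have -> : c * (2 * t) ^+ 2 = 4 * (c * t ^+ 2) by ring.
by [].
Qed.

(** Raising each [a i] by [e * a i - loss (a i)] gains [e] times the sum of the [a i], minus the
    losses, up to a second order error. The extra term on the left records that, in a small family,
    a first child whose [b] is at least twice its [a] gains a fixed fraction of [b]; the indicator
    on the right pays for the families where some [a i] is too large for this. *)
Lemma at_least_one_flatness k k0 (a b : nat -> R) : (0 < k)%N -> (0 < k0)%N ->
    probs a -> probs b -> (forall i, a i <= b i) ->
    (forall i, (1 + e) * a i - c * a i ^+ 2 <= b i) ->
  (1 + e) * at_least_one k a +
    (k <= k0)%:R * (8^-1 * (b 0%N * (2 * a 0%N <= b 0%N)%R%:R)) <=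
  at_least_one k b +
    \sum_(i < k) (loss (a i) + 8^-1 * ((4 * k0%:R)^-1 < a i)%R%:R) +
    k%:R * \sum_(i < k) (2 * e * a i ^+ 2).
Proof.
move=> k_gt0 k0_gt0 a01 b01 ab ab2.
(* This is the maximum of [a i] and [(1 + e) * a i - c * a i ^+ 2], the best lower bound for [b i]
   that the hypotheses give. *)
pose w i := a i + (e * a i - loss (a i)).
have a_ge0 i : 0 <= a i by have /andP[] := a01 i.
have lossa i : 0 <= loss (a i) by exact: loss_ge0.
have aw i : a i <= w i by rewrite /w; have := loss_le_lin (a i); lra.
have w2 i : w i <= (1 + e) * a i by rewrite /w; have := lossa i; lra.
have ea i : e * a i <= 2^-1 * a i by rewrite ler_wpM2r.
have wb i : w i <= b i.
  by rewrite /w /loss; case: (leP (e * a i)) => _; have := ab i; have := ab2 i; lra.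
have w01 i : 0 <= w i <= 1.
  by have := aw i; have := wb i; have := a01 i; have := b01 i; lra.
have hS : at_least_one k a <= \sum_(i < k) a i by exact: at_least_one_le_sum.
have hw : (1 + e) * at_least_one k a <= at_least_one k w +
    \sum_(i < k) loss (a i) + k%:R * \sum_(i < k) (2 * e * a i ^+ 2).
  have := at_least_one_diff_ge k _ _ a01 w01 aw.
  have -> : \sum_(i < k) (w i - a i) =
      e * \sum_(i < k) a i - \sum_(i < k) loss (a i).
    rewrite mulr_sumr -sumrB; apply: eq_bigr => i _; rewrite /w; lra.
  have W2 : \sum_(i < k) w i <= 2 * \sum_(i < k) a i.
    rewrite mulr_sumr; apply: ler_sum => i _; have := w2 i; have := ea i; have := a_ge0 i; lra.
  have L0 : 0 <= \sum_(i < k) loss (a i) by apply: sumr_ge0.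
  have LS : \sum_(i < k) loss (a i) <= e * \sum_(i < k) a i.
    by rewrite mulr_sumr; apply: ler_sum => i _; exact: loss_le_lin.
  rewrite -mulr_sumr.
  have := sum_sqr_le k a.
  have W0 : 0 <= \sum_(i < k) w i.
    by apply: sumr_ge0 => i _; have /andP[] := w01 i.
  have S0 : 0 <= \sum_(i < k) a i by apply: sumr_ge0.
  move: hS L0 LS W2 W0 S0; set S := \sum_(i < k) a i; set L := \sum_(i < k) loss _.
  set W := \sum_(i < k) w i; set Q := \sum_(i < k) _ ^+ 2.
  move=> hS L0 LS W2 W0 S0 hQ h.
  have h1 : (e * S - L) * W <= (e * S) * (2 * S).
    by apply: ler_pM => //; lra.
  have h2 : e * at_least_one k a <= e * S by rewrite ler_pM2l.
  have h3 : 2 * e * S ^+ 2 <= 2 * e * (k%:R * Q).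
    by apply: ler_wpM2l => //; rewrite mulr_ge0 ?ltW.
  by nra.
have hI : 0 <= \sum_(i < k) (8^-1 * ((4 * k0%:R)^-1 < a i)%R%:R) :> R.
  by apply: sumr_ge0 => i _; apply: mulr_ge0; [lra|exact: ler0n].
rewrite big_split /=.
have [kk0|_] := leqP k k0; last first.
  rewrite mul0r addr0.
  by have := at_least_one_le k _ _ w01 b01 wb; lra.
rewrite mul1r.
have [b2|_] := leP (2 * a 0%N) (b 0%N); last first.
  rewrite !mulr0 addr0.
  by have := at_least_one_le k _ _ w01 b01 wb; lra.
rewrite mulr1.
(* A single large level makes the indicator sum at least 1/8, which covers the claimed gain because
   [b 0 <= 1]. *)
have [/existsP[i ai]|] := boolP [exists i : 'I_k, (4 * k0%:R)^-1 < a i].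
  have : 8^-1 <= \sum_(i < k) (8^-1 * ((4 * k0%:R)^-1 < a i)%R%:R) :> R.
    rewrite (bigD1 i) //= ai mulr1 lerDl; apply: sumr_ge0 => j _.
    by apply: mulr_ge0; [lra|exact: ler0n].
  by have := at_least_one_le k _ _ w01 b01 wb; have /andP[] := b01 0%N; lra.
rewrite negb_exists => /forallP ha.
have sw : \sum_(i < k) w i <= 2^-1.
  apply: (@le_trans _ _ (\sum_(i < k) (2 * (4 * k0%:R)^-1))).
    apply: ler_sum => i _; have := ha i; rewrite -leNgt; have := w2 i.
    by have := ea i; have := a_ge0 i; lra.
  rewrite sumr_const card_ord -[_ *+ k]mulr_natl.
  have k0R : 0 < k0%:R :> R by rewrite ltr0n.
  have kk : k%:R <= k0%:R :> R by rewrite ler_nat.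
  have -> : k%:R * (2 * (4 * k0%:R)^-1) = (k%:R / k0%:R) / 2 :> R by field; lra.
  have : k%:R / k0%:R <= 1 :> R by rewrite ler_pdivrMr ?mul1r.
  lra.
have := at_least_one_first_ge k _ _ k_gt0 b01 w01 wb.
(* From [w 0 <= 3/2 * a 0 <= 3/4 * b 0]. With the factor 1/2 left by [sw] this yields the constant
   1/8. *)
have g : b 0%N / 4 <= b 0%N - w 0%N.
  by have := w2 0%N; have := ea 0%N; have := a_ge0 0%N; lra.
have b_ge0 : 0 <= b 0%N by have /andP[] := b01 0%N.
have h : (b 0%N / 4) * 2^-1 <= (b 0%N - w 0%N) * (1 - \sum_(i < k) w i).
  by apply: ler_pM => //; lra.
by lra.
Qed.

End flatness_loss.

(** [s] marks the children that land well, each succeeding with probability [t]. A second such child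
    adds [t * (1 - t)]; a gain linear in their number [N] fails for large [N], where the last term
    takes over. After averaging, a large [A] makes that term small against the surplus [m - 1]. *)
Lemma at_least_one_growth {R : realType} k (A t : R) (s : nat -> bool) :
    (0 < k)%N -> 0 < A -> 0 <= t <= 1 ->
  A * (t * (s 0%N)%:R) + t * (1 - t) * \sum_(i < k) (s i)%:R <=
  A * at_least_one k (fun i => t * (s i)%:R) + t * (1 - t) +
    k%:R * \sum_(i < k) (t * (1 - t) / A * (s i)%:R).
Proof.
move=> k_gt0 A0 /andP[t0 t1]; rewrite -mulr_sumr.
have -> : at_least_one k (fun i => t * (s i)%:R) = 1 - (1 - t) ^+ (\sum_(i < k) s i)%N.
  congr (_ - _); elim: k {k_gt0} => [|k IH]; first by rewrite !big_ord0.
  by rewrite !big_ord_recr /= IH exprD; case: (s k) => /=; rewrite ?mulr1 ?mulr0 ?subr0 ?expr1 ?expr0 ?mulr1.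
have -> : \sum_(i < k) (s i)%:R = (\sum_(i < k) s i)%N%:R :> R by rewrite natr_sum.
have s0N : (s 0%N <= \sum_(i < k) s i)%N.
  by case: k k_gt0 => // k _; rewrite big_ord_recl /= leq_addr.
have Nk : (\sum_(i < k) s i <= k)%N.
  by rewrite -[leqRHS]card_ord -sum1_card; apply: leq_sum => i _; case: (s i).
move: Nk s0N; set N := (\sum_(i < k) s i)%N => Nk s0N.
have q0 : 0 <= t * (1 - t) by apply: mulr_ge0; lra.
have hN : N%:R <= k%:R :> R by rewrite ler_nat.
have hK : t * (1 - t) * (N%:R ^+ 2 / A) <= k%:R * (t * (1 - t) / A * N%:R).
  have -> : k%:R * (t * (1 - t) / A * N%:R) = t * (1 - t) * (N%:R * k%:R / A).
    by field; lra.
  apply: ler_wpM2l => //; rewrite ler_pM2r ?invr_gt0 // expr2.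
  by apply: ler_wpM2l.
case: (posnP N) => [N0|Npos].
  have -> : s 0%N = false by move: s0N; rewrite N0; case: (s 0%N).
  by rewrite N0 expr0 subrr ?mulr0n !mulr0 !add0r addr0.
have s1 : (s 0%N)%:R <= 1 :> R by case: (s 0%N).
have [N1|N2] := leqP N 1.
  have -> : N = 1%N by apply/eqP; rewrite eqn_leq N1.
  rewrite expr1 in hK *.
  have : A * (t * (s 0%N)%:R) <= A * t by rewrite ler_pM2l // ler_piMr.
  have : 0 <= k%:R * (t * (1 - t) / A * 1) by rewrite !mulr_ge0 ?invr_ge0 //; lra.
  nra.
have pw : (1 - t) ^+ N <= (1 - t) ^+ 2 by apply: ler_wiXn2l => //; lra.
have hA : A * (t * (s 0%N)%:R) <= A * t by rewrite ler_pM2l // ler_piMr.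
have h1 : A * t + A * (t * (1 - t)) <= A * (1 - (1 - t) ^+ N).
  by rewrite -mulrDr ler_pM2l //; nra.
have h2 : t * (1 - t) * N%:R <=
    A * (t * (1 - t)) + t * (1 - t) + t * (1 - t) * (N%:R ^+ 2 / A).
  rewrite -[X in _ <= _ + X + _]mulr1 [A * _]mulrC -!mulrDr.
  apply: ler_wpM2l => //.
  (* Up to [A + 1] the gain of the second child suffices; beyond it [N <= N ^+ 2 / A]. *)
  have [|NA] := leP N%:R (A + 1).
    have : 0 <= N%:R ^+ 2 / A by rewrite divr_ge0 ?exprn_ge0 ?ler0n // ltW.
    by move=> h3 h4; lra.
  have : N%:R <= N%:R ^+ 2 / A :> R.
    by rewrite ler_pdivlMr // expr2; apply: ler_wpM2l => //; lra.
  lra.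
lra.
Qed.

(** * Uniqueness of measures and partitions *)

Section rays.
Context {R : realType}.

Lemma measurable_fun_rays d (T : measurableType d) (f : T -> R) :
  (forall x, measurable [set w | f w <= x]) -> measurable_fun setT f.
Proof.
move=> h; apply: (measurability _ (RGenOInfty.measurableE R)).
move=> _ [_ [x ->] <-]; rewrite setTI.
rewrite [X in measurable X](_ : _ = ~` [set w | f w <= x]); first exact: measurableC.
by apply/seteqP; split => w /=; rewrite in_itv /= andbT ltNge => /negP.
Qed.

Lemma measure_rays_unique (m1 m2 : {measure set R -> \bar R}) :
  (m1 setT < +oo)%E ->
  (forall x, m1 [set y | y <= x] = m2 [set y | y <= x]) ->
  forall A, measurable A -> m1 A = m2 A.
Proof.
move=> m1_fin m12.
pose G : set (set R) := [set A | exists x, A = [set y | y <= x]].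
have GE A : measurable A -> <<s G >> A.
  have mid : measurable_fun setT (fun x : g_sigma_algebraType G => x : R).
    by apply: measurable_fun_rays => x; apply: sub_sigma_algebra; exists x.
  by move=> mA; have := mid measurableT A mA; rewrite setTI.
have mG A : G A -> measurable A.
  by move=> [x ->]; rewrite [X in measurable X](_ : _ = `]-oo, x]%classic).
move=> A /GE.
apply: (@g_sigma_algebra_measure_unique _ R _ G mG (fun n => [set y : R | y <= n%:R])).
- by move=> n; exists n%:R.
- apply/seteqP; split => // y _; exists (Num.bound y) => //=.
  by have [y0|y0] := leP 0 y; [exact: ltW (archi_boundP y0)|rewrite (le_trans (ltW y0))].
- move=> _ _ [x ->] [y ->]; exists (Num.min x y).
  by apply/seteqP; split => z /=; rewrite le_min; [move=> [-> ->]|move=> /andP].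
- by move=> _ [x ->]; exact: m12.
- move=> n; apply: le_lt_trans m1_fin; apply: le_measure; rewrite ?inE //.
  by apply: mG; exists n%:R.
Qed.

Lemma measurable_fun_natr_bool d (T : measurableType d) (b : T -> bool) :
  measurable_fun setT b -> measurable_fun setT (fun w => (b w)%:R : R).
Proof.
move=> mb; have -> : (fun w => (b w)%:R) = (fun w => if b w then 1 else 0 : R).
  by apply/funext => w; case: (b w).
exact: measurable_fun_ifT.
Qed.

Definition lower_box k (x : k.-tuple R) : set (k.-tuple R) :=
  [set y | forall i, tnth y i <= tnth x i].

Lemma measurable_lower_box k (x : k.-tuple R) : measurable (lower_box k x).
Proof.
have -> : lower_box k x = \big[setI/setT]_(i < k) [set y | tnth y i <= tnth x i].
  rewrite -bigcap_seq; apply/seteqP; split => y /= h i; first by move=> _; exact: h.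
  by apply: (h i); rewrite /= mem_index_enum.
apply: bigsetI_measurable => i _.
have := @measurable_tnth _ R k i measurableT _ (measurable_itv `]-oo, (tnth x i)]).
by rewrite setTI; congr measurable; apply/seteqP; split => y /=; rewrite in_itv.
Qed.

Lemma measure_lower_box_unique k (m1 m2 : {measure set (k.-tuple R) -> \bar R}) :
  (m1 setT < +oo)%E ->
  (forall x, m1 (lower_box k x) = m2 (lower_box k x)) ->
  forall A, measurable A -> m1 A = m2 A.
Proof.
move=> m1_fin m12.
pose G : set (set (k.-tuple R)) := [set A | exists x, A = lower_box k x].
have GE A : measurable A -> <<s G >> A.
  have mid : measurable_fun setT (fun x : g_sigma_algebraType G => x : k.-tuple R).
    apply/measurable_fun_tnthP => i; apply: measurable_fun_rays => x.
    (* A half-space in coordinate [i] is the increasing union of the boxes whose other sides are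
       [n]. *)
    pose t n : k.-tuple R := [tuple if j == i then x else n%:R | j < k].
    rewrite [X in measurable X](_ : _ = \bigcup_n lower_box k (t n)).
      by apply: bigcupT_measurable => n; apply: sub_sigma_algebra; exists (t n).
    apply/seteqP; split => y /=; last first.
      by move=> [n _ /(_ i)]; rewrite tnth_mktuple eqxx.
    move=> yx; exists (\max_(j < k) Num.bound (tnth y j))%N => // j.
    rewrite tnth_mktuple; case: eqP => [->//|_].
    apply: (@le_trans _ _ (Num.bound (tnth y j))%:R).
      have [y0|y0] := leP 0 (tnth y j); first exact: ltW (archi_boundP y0).
      by rewrite (le_trans (ltW y0)).
    by rewrite ler_nat; exact: (leq_bigmax (F := fun j => Num.bound (tnth y j))).
  by move=> mA; have := mid measurableT A mA; rewrite setTI.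
have mG A : G A -> measurable A by move=> [x ->]; exact: measurable_lower_box.
move=> A /GE.
apply: (@g_sigma_algebra_measure_unique _ R _ G mG
  (fun n => lower_box k [tuple n%:R | _ < k])).
- by move=> n; exists [tuple n%:R | _ < k].
- apply/seteqP; split => // y _; exists (\max_(j < k) Num.bound (tnth y j))%N => //= j.
  rewrite tnth_mktuple; apply: (@le_trans _ _ (Num.bound (tnth y j))%:R).
    have [y0|y0] := leP 0 (tnth y j); first exact: ltW (archi_boundP y0).
    by rewrite (le_trans (ltW y0)).
  by rewrite ler_nat; exact: (leq_bigmax (F := fun j => Num.bound (tnth y j))).
- move=> _ _ [x ->] [y ->]; exists [tuple Num.min (tnth x j) (tnth y j) | j < k].
  apply/seteqP; split => z /=.
    by move=> [h1 h2] i; rewrite tnth_mktuple le_min h1 h2.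
  by move=> h; split=> i; have := h i; rewrite tnth_mktuple le_min => /andP[].
- by move=> _ [x ->]; exact: m12.
- move=> n; apply: le_lt_trans m1_fin; apply: le_measure; rewrite ?inE //.
  exact: measurable_lower_box.
Qed.

End rays.

Section countable_partition.
Context d (T : measurableType d) (R : realType) (P : {measure set T -> \bar R}).
Variables (K : T -> nat) (mK : forall k, measurable [set w | K w = k]).

Lemma measurable_fun_cases d' (U : measurableType d') (f : T -> U) (g : nat -> T -> U) :
  (forall w, f w = g (K w) w) -> (forall k, measurable_fun setT (g k)) ->
  measurable_fun setT f.
Proof.
move=> fg mg _ B mB; rewrite setTI.
rewrite [X in measurable X](_ : _ = \bigcup_k ([set w | K w = k] `&` g k @^-1` B)).
  apply: bigcupT_measurable => k; apply: measurableI => //.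
  by have := mg k measurableT B mB; rewrite setTI.
apply/seteqP; split => w /=; first by rewrite fg => h; exists (K w).
by move=> [k _ [<-]]; rewrite fg.
Qed.

Lemma integral_cases (f : T -> \bar R) : measurable_fun setT f -> (forall w, 0 <= f w)%E ->
  (\int[P]_w f w = \sum_(k <oo) \int[P]_(w in [set w | K w = k]) f w)%E.
Proof.
move=> mf f0; rewrite -ge0_integral_bigcup //.
- by congr (integral P _ f); apply/seteqP; split => w // _; exists (K w).
- exact: measurable_funTS.
- by move=> i j _ _ [w [/= <- <-]].
Qed.

End countable_partition.

(** * Means of bounded functions *)

Section mean.
Context {R : realType} (mu : probability R R).
Implicit Types f g : R -> R.

(** Integrals of such functions are finite, so means can be computed as real numbers. *)
Definition bounded_ge0 f :=
  measurable_fun setT f /\ exists C, forall x, 0 <= f x <= C.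

Definition mean f : R := fine (\int[mu]_y (f y)%:E)%E.

Lemma bounded_ge0_fun_ge0 f : bounded_ge0 f -> forall x, 0 <= f x.
Proof. by move=> [_ [C fC]] x; have /andP[] := fC x. Qed.

Lemma bounded_ge0D f g : bounded_ge0 f -> bounded_ge0 g ->
  bounded_ge0 (fun y => f y + g y).
Proof.
move=> [mf [Cf fC]] [mg [Cg gC]]; split; first exact: measurable_funD.
by exists (Cf + Cg) => x; have := fC x; have := gC x; lra.
Qed.

Lemma bounded_ge0M f g : bounded_ge0 f -> bounded_ge0 g ->
  bounded_ge0 (fun y => f y * g y).
Proof.
move=> [mf [Cf fC]] [mg [Cg gC]]; split; first exact: measurable_funM.
exists (Cf * Cg) => x; have /andP[f0 f1] := fC x; have /andP[g0 g1] := gC x.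
by rewrite mulr_ge0 //= ler_pM.
Qed.

Lemma bounded_ge0_cst c : 0 <= c -> bounded_ge0 (fun=> c).
Proof. by move=> c0; split => //; exists c => _; rewrite c0 lexx. Qed.

Lemma bounded_ge0Z c f : 0 <= c -> bounded_ge0 f -> bounded_ge0 (fun y => c * f y).
Proof. by move=> c0; apply: bounded_ge0M; exact: bounded_ge0_cst. Qed.

Lemma bounded_ge0_bool (b : R -> bool) :
  measurable_fun setT b -> bounded_ge0 (fun y => (b y)%:R).
Proof.
move=> mb; split; last by exists 1 => x; case: (b x); rewrite ?lexx ?ler01.
exact: measurable_fun_natr_bool.
Qed.

Lemma measurable_EFin_bounded f : bounded_ge0 f ->
  measurable_fun setT (fun y => (f y)%:E).
Proof. by move=> [mf _]; exact/measurable_EFinP. Qed.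

Lemma integral_mean f : bounded_ge0 f -> (\int[mu]_y (f y)%:E)%E = (mean f)%:E.
Proof.
move=> bf; rewrite /mean fineK // ge0_fin_numE; last first.
  by apply: integral_ge0 => y _; rewrite lee_fin; exact: bounded_ge0_fun_ge0.
have [_ [C fC]] := bf.
apply: (@le_lt_trans _ _ (\int[mu]_y C%:E)%E).
  apply: ge0_le_integral => //.
  - by move=> y _; rewrite lee_fin; exact: bounded_ge0_fun_ge0.
  - exact: measurable_EFin_bounded.
  - by move=> y _; rewrite lee_fin; have /andP[] := fC y.
by rewrite integral_cst //= probability_setT mule1 ltry.
Qed.

Lemma meanD f g : bounded_ge0 f -> bounded_ge0 g ->
  mean (fun y => f y + g y) = mean f + mean g.
Proof.
move=> bf bg; apply: EFin_inj; rewrite EFinD -!integral_mean //; last first.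
  exact: bounded_ge0D.
under eq_integral do rewrite EFinD.
by apply: ge0_integralD => //; (try exact: measurable_EFin_bounded);
  move=> y _; rewrite lee_fin; exact: bounded_ge0_fun_ge0.
Qed.

Lemma meanZ c f : 0 <= c -> bounded_ge0 f -> mean (fun y => c * f y) = c * mean f.
Proof.
move=> c0 bf; apply: EFin_inj; rewrite EFinM -!integral_mean //; last first.
  exact: bounded_ge0Z.
under eq_integral do rewrite EFinM.
rewrite ge0_integralZl_EFin //; last exact: measurable_EFin_bounded.
by move=> y _; rewrite lee_fin; exact: bounded_ge0_fun_ge0.
Qed.

Lemma mean_cst c : mean (fun=> c) = c.
Proof. by rewrite /mean integral_cst //= probability_setT mule1. Qed.

Lemma mean_le f g : bounded_ge0 f -> bounded_ge0 g -> (forall y, f y <= g y) ->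
  mean f <= mean g.
Proof.
move=> bf bg fg; rewrite -lee_fin -!integral_mean //; apply: ge0_le_integral => //.
- by move=> y _; rewrite lee_fin; exact: bounded_ge0_fun_ge0.
- exact: measurable_EFin_bounded.
- exact: measurable_EFin_bounded.
- by move=> y _; rewrite lee_fin.
Qed.

Lemma mean_ge0 f : bounded_ge0 f -> 0 <= mean f.
Proof.
move=> bf; apply: fine_ge0; apply: integral_ge0 => y _; rewrite lee_fin.
exact: bounded_ge0_fun_ge0.
Qed.

Lemma mean_bool (b : R -> bool) : measurable [set y | b y] ->
  mean (fun y => (b y)%:R) = fine (mu [set y | b y]).
Proof.
move=> mb; rewrite /mean -[in RHS](setIT [set y | b y]) -integral_indic //.
congr fine; apply: eq_integral => y _; rewrite indicE.
by congr (_%:R%:E); rewrite mem_setE.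
Qed.

Definition upper_tail (y : R) : R := fine (mu `]y, +oo[%classic).

Lemma upper_tail_ge0 y : 0 <= upper_tail y.
Proof. exact: fine_ge0. Qed.

Lemma mean_gt c : mean (fun y => (c < y)%R%:R) = upper_tail c.
Proof.
rewrite /upper_tail.
have <- : [set y | c < y] = `]c, +oo[%classic.
  by apply/seteqP; split => y /=; rewrite in_itv /= andbT.
rewrite mean_bool //.
by rewrite [X in measurable X](_ : _ = `]c, +oo[%classic) //; apply/seteqP; split => y /=; rewrite in_itv /= andbT.
Qed.

Lemma bounded_ge0_gt c : bounded_ge0 (fun y => (c < y)%R%:R).
Proof. by apply: bounded_ge0_bool; exact: measurable_fun_ltr. Qed.

Lemma mean_ccdf f : bounded_ge0 f ->
  (mean f)%:E =
  (\int[lebesgue_measure]_(r in `[0%R, +oo[) mu [set y | (r < f y)%R])%E.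
Proof.
move=> bf; have [mf _] := bf; rewrite -integral_mean //.
pose f' : {mfun R >-> R} := HB.pack f (isMeasurableFun.Build _ _ _ _ _ mf).
have := @ge0_expectation_ccdf _ _ _ mu f' (bounded_ge0_fun_ge0 f bf).
rewrite expectation_def => ->.
apply: eq_integral => r _; rewrite /ccdf /distribution /pushforward /=.
by congr (mu _); apply/seteqP; split => y /=; rewrite in_itv /= andbT.
Qed.

Lemma measurable_super_level f r : measurable_fun setT f -> measurable [set y | r < f y].
Proof.
move=> mf; have := mf measurableT _ (measurable_itv `]r, +oo[); rewrite setTI.
by congr measurable; apply/seteqP; split => y /=; rewrite in_itv /= andbT.
Qed.

Lemma measurable_super_level_measure f : measurable_fun setT f ->
  measurable_fun setT (fun r : R => mu [set y | r < f y]).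
Proof.
move=> mf.
pose f' : {mfun R >-> R} := HB.pack f (isMeasurableFun.Build _ _ _ _ _ mf).
apply: eq_measurable_fun (@ccdf_measurable _ _ _ mu f') => r _.
rewrite /ccdf /distribution /pushforward /=.
by congr (mu _); apply/seteqP; split => y /=; rewrite in_itv /= andbT.
Qed.

(** Layer-cake: a set where [f] exceeds [r] is a ray to the right of [c]. Moving its endpoint left
    by [c] divides its measure by at least [q], and the shifted ray lies in the corresponding set of
    the translate of [f] by [M]. *)
Lemma mean_shift_le f (c M q : R) : 0 <= q -> c < M ->
    (forall t, 0 <= t -> upper_tail (t + c) <= q * upper_tail t) ->
    bounded_ge0 f -> {homo f : x y / x <= y} ->
    (forall y, y <= c -> f y = 0) ->
  mean f <= q * mean (fun y => f (y + M)).
Proof.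
move=> q0 cM tail bf fmono f0; have [mf [C fC]] := bf.
have bfM : bounded_ge0 (fun y => f (y + M)).
  split; last by exists C => x; exact: fC.
  by apply: (measurableT_comp mf); exact: measurable_funD.
rewrite -lee_fin EFinM !mean_ccdf // -ge0_integralZl_EFin //; last first.
  by apply: measurable_funTS; apply: measurable_super_level_measure; case: bfM.
apply: ge0_le_integral => //.
- by apply: measurable_funTS; apply: measurable_super_level_measure.
- apply: measurable_funTS; apply: emeasurable_funM => //.
  by apply: (measurable_super_level_measure (fun y => f (y + M))); case: bfM.
move=> r; rewrite /= in_itv /= andbT => r0.
have mA : measurable [set y | r < f y] by exact: measurable_super_level.
have mB : measurable [set y | r < f (y + M)].
  by apply: (measurable_super_level (fun y => f (y + M))); case: bfM.
have [[a0 Aa0]|A0] := pselect ([set y | r < f y] !=set0); last first.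
  have -> : [set y | r < f y] = set0 by apply/seteqP; split => // y Ay; case: A0; exists y.
  by rewrite measure0 mule_ge0.
set t := inf [set y | r < f y].
have Ac y : r < f y -> c < y.
  by move=> ry; rewrite ltNge; apply/negP => yc; move: ry; rewrite f0 // ltNge r0.
have hinf : has_inf [set y | r < f y].
  by split; [exists a0 | exists c => y /Ac/ltW].
(* The endpoint must be at least [c], since the tail bound starts at 0. The slack [M - c > 0] allows
   an open ray whether or not the infimum [t] is attained. *)
pose s := Num.max c (t - (M - c)).
apply: (@le_trans _ _ (mu `]s, +oo[%classic)).
  apply: le_measure; rewrite ?inE // => y Ay; rewrite /= in_itv /= andbT gt_max Ac //=.
  have : t <= y by apply: ge_inf => //; case: hinf.
  by lra.
have sc : c <= s by rewrite le_max lexx.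
apply: (@le_trans _ _ (q%:E * mu `](s - c)%R, +oo[%classic)%E).
  have := tail (s - c); rewrite subrK subr_ge0 => /(_ sc).
  by rewrite -lee_fin EFinM /upper_tail !fineK // fin_num_measure.
apply: lee_wpmul2l; first by rewrite lee_fin.
apply: le_measure; rewrite ?inE // => y; rewrite /= in_itv /= andbT => ys.
have ty : t < y + M.
  have : t - (M - c) <= s by rewrite le_max lexx orbT.
  by lra.
have [a ra ay] := inf_lt hinf.1 ty.
by apply: (lt_le_trans ra); apply: fmono; exact: ltW.
Qed.

End mean.

(** * Propagation of the decay of tails *)

Definition tail_fun {R : realType} (u : R -> R) :=
  {homo u : x y /~ x <= y} /\ forall x, 0 <= u x <= 1.

(* [u] and [v] stand for the tails of the maximum one generation apart, [mu] for
   the common marginal of the displacements, [m] for the mean and [m1] for a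
   bound on the second moment of the number of children. The definition says
   that pointwise inequalities between functionals of a family of [k] children
   displaced by [y 0, ..., y (k - 1)] may be averaged. *)
Definition branching_step {R : realType} (mu : probability R R) (m m1 : R)
    (u v : R -> R) :=
  forall (A1 A2 C x1 x2 : R) (k0 : nat) (f0 f1 f2 f3 : R -> R),
    0 <= A1 -> 0 <= A2 -> 0 <= C -> (0 < k0)%N ->
    bounded_ge0 f0 -> bounded_ge0 f1 -> bounded_ge0 f2 -> bounded_ge0 f3 ->
    (forall k (y : nat -> R), (0 < k)%N ->
      A1 * at_least_one k (fun i => v (x1 - y i)) + (k <= k0)%N%:R * f0 (y 0%N) +
        \sum_(i < k) f3 (y i) <=
      A2 * at_least_one k (fun i => v (x2 - y i)) + C + \sum_(i < k) f1 (y i) +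
        k%:R * \sum_(i < k) f2 (y i)) ->
    A1 * u x1 + (1 - m1 / k0%:R) * mean mu f0 + m * mean mu f3 <=
    A2 * u x2 + C + m * mean mu f1 + m1 * mean mu f2.

Section tail_functions.
Context {R : realType}.
Implicit Types (u v : R -> R).

Lemma bounded_ge0_tail_fun v x : tail_fun v -> bounded_ge0 (fun y => v (x - y)).
Proof.
move=> [vmono v01]; split; last by exists 1 => y; exact: v01.
apply: (@nondecreasing_measurable _ setT (fun y => v (x - y))) => // y z yz.
by apply: vmono; rewrite lerD2l lerN2.
Qed.

Lemma bounded_ge0_loss (e kap : R) (a : R -> R) : 0 < e -> 0 < kap ->
  bounded_ge0 a -> bounded_ge0 (fun y => loss e kap (a y)).
Proof.
move=> e0 kap0 [ma [C aC]]; split.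
  apply: measurable_minr; apply: measurable_funM => //.
  exact: measurable_funX.
exists (e * C) => y; have /andP[a0 a1] := aC y.
rewrite loss_ge0 //=; apply: (le_trans (loss_le_lin _ _ _)).
by rewrite ler_pM2l.
Qed.

Variables (mu : probability R R) (m m1 : R).

Lemma upper_tail_le1 y : upper_tail mu y <= 1.
Proof.
rewrite /upper_tail -lee_fin fineK ?fin_num_measure //.
exact: probability_le1.
Qed.

(** From [x - B], each child that jumps above [-B] succeeds with probability at least [t]; then use
    the second order lower bound. [t] is free below [v x] because the left-hand side is not monotone
    in it. *)
Lemma branching_step_ge (u v : R -> R) x B t : 0 <= t -> tail_fun v ->
    branching_step mu m m1 u v -> t <= v x ->
  (t * m - t ^+ 2 * m1) * upper_tail mu (- B) <= u (x - B).
Proof.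
move=> t0 [vmono v01] step tv.
have tv1 : t <= 1 by have /andP[] := v01 x; lra.
have bg := bounded_ge0_gt (- B); have b0 := @bounded_ge0_cst R 0 (lexx 0).
have := step 0 1 0 x (x - B) 1%N _ _ _ _ (lexx 0) ler01 (lexx 0) isT
  b0 b0 (bounded_ge0Z (t ^+ 2) _ (sqr_ge0 t) bg) (bounded_ge0Z t _ t0 bg).
rewrite !meanZ ?sqr_ge0 // !mean_cst mean_gt mul1r mul0r !mulr0 !addr0 add0r.
move=> h; suff : m * (t * upper_tail mu (- B)) <=
    u (x - B) + m1 * (t ^+ 2 * upper_tail mu (- B)) by lra.
apply: h => k y k0.
have -> : \sum_(i < k) (0 : R) = 0 by rewrite big1.
rewrite mul0r mulr0 !add0r mul1r !addr0.
pose s i := t * (- B < y i)%R%:R.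
have s01 : probs s by move=> i; rewrite /s; case: (_ < _)%R; rewrite ?mulr1 ?mulr0 ?lexx ?ler01 ?t0.
have := at_least_one_ge_sum k s s01.
have : at_least_one k s <= at_least_one k (fun i => v (x - B - y i)).
  apply: at_least_one_le => //.
  move=> i; rewrite /s; case: ltP => yB; last by rewrite mulr0; have /andP[] := v01 (x - B - y i).
  by rewrite mulr1 (le_trans tv) // vmono //; lra.
have -> : \sum_(i < k) s i ^+ 2 = \sum_(i < k) (t ^+ 2 * (- B < y i)%R%:R).
  by apply: eq_bigr => i _; rewrite /s exprMn; case: (_ < _)%R; rewrite ?expr1n ?expr0n.
rewrite /s; lra.
Qed.

End tail_functions.

(** * One generation of the inequality with quadratic error *)

Section flatness.
Context {R : realType}.
Variables (mu : probability R R) (m m1 e c B q kap : R) (k0 : nat).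
Variables (e_gt0 : 0 < e) (e_le : e <= 4^-1) (c_gt0 : 0 < c) (B_gt0 : 0 < B).
Variables (m_ge1 : 1 <= m) (m_le : m <= m1) (q_ge0 : 0 <= q) (q_le : q <= 8^-1).
Variables (em : (1 + e) ^+ 2 <= (1 - e) * (1 - 2 * e) ^+ 2 * m).
Variables (left : 1 - e <= upper_tail mu (- B)).
Variables (tail : forall t, 0 <= t -> upper_tail mu (t + c) <= q * upper_tail mu t).
Variables (k0_gt0 : (0 < k0)%N) (k0_ge : 2 * m1 <= k0%:R).
(** The total weight of [L] in the final estimate: [m1] from the loss, [m1 * k0 / (2 * e)] from the
    indicator of large levels, [2 * m1] from the squares. *)
Let C3 := 3 * m1 + m1 * k0%:R / (2 * e).
Variables (qC3 : C3 * (2 * q * e) <= 16^-1) (qC3' : m1 * q + 8 * q * C3 <= e / 2).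
Variables (kap_ge : e * (4 * k0%:R) <= kap) (kap_ge' : 4 * m1 <= kap).
Let M := c + B.

Local Ltac params := move: (e_gt0) (e_le) (c_gt0) (B_gt0) (m_ge1) (m_le)
  (q_ge0) (q_le) (kap_ge) (kap_ge') => *.

(* [v (x - M) >= (1 + e) * v x] up to a quadratic error, which dominates the
   nonlinearity of a branching step and is contracted by it. *)
Definition not_flat (v : R -> R) :=
  forall x, (1 + e) * v x - kap * v x ^+ 2 <= v (x - M).

Section step.
Variables (u v : R -> R) (tu : tail_fun u) (tv : tail_fun v).
Variables (step : branching_step mu m m1 u v) (v_not_flat : not_flat v).
Variable (x : R).
Let l := u x.
Hypotheses (kap_l : kap * l <= e) (flat : u (x - M) < (1 + e) * l).
Let a y := v (x - y).
Let b y := v (x - M - y).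
(** The factor by which flatness lowers the tail of the children; [em] is tuned to give
    [m * rho ^+ 2 <= 1 - e]. *)
Let rho := (1 + e) / ((1 - 2 * e) * m).
(** The loss at levels above [l], where contraction says nothing. Its mean [L] is to be paid for by
    [H], the gain from jumps for which moving by [M] at least doubles the tail. *)
Let f t := loss e kap t * (l < t)%R%:R.
Let H := mean mu (fun y => b y * (2 * a y <= b y)%R%:R).
Let L := mean mu (fun y => f (a y)).

Let kap_gt0 : 0 < kap. Proof. by params; lra. Qed.
Let l_ge0 : 0 <= l. Proof. by have /andP[] := tu.2 x. Qed.
Let a01 y : 0 <= a y <= 1. Proof. exact: tv.2. Qed.
Let b01 y : 0 <= b y <= 1. Proof. exact: tv.2. Qed.
Let ab y : a y <= b y. Proof. by params; apply: tv.1; rewrite /M; lra. Qed.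

Let ml_small : 2 * l * m1 <= e.
Proof.
params.
have : l * (4 * m1) <= l * kap by apply: ler_wpM2l.
move: (kap_l).
by lra.
Qed.

(** If [v (x - c)] were larger, the children would lift [u (x - M)] above [(1 + e) * l]. The lower
    bound used has a quadratic correction and works only at small levels, so [v (x - c) > 2 * l] is
    first excluded by testing the level [2 * l], known to be small from [kap_l]. *)
Let a_le_rho : v (x - c) <= rho * l.
Proof.
params.
have bound t : 0 <= t -> t <= v (x - c) -> t * m1 <= e -> t * (m * (1 - 2 * e)) <= (1 + e) * l.
  move=> t0 tv' tm.
  have := branching_step_ge _ _ _ u v (x - c) B t t0 tv step tv'.
  have -> : x - c - B = x - M by rewrite /M; lra.
  move=> h; apply: le_trans (ltW flat); apply: le_trans h.
  have h1 : t * m * (1 - e) <= t * m - t ^+ 2 * m1.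
    have : t * (t * m1) <= t * e by apply: ler_wpM2l.
    have : t * e <= t * e * m by rewrite ler_peMr // mulr_ge0 // ltW.
    by rewrite expr2; lra.
  have tm0 : 0 <= t * m by apply: mulr_ge0 => //; lra.
  apply: (@le_trans _ _ (t * m * (1 - e) * (1 - e))).
    have : 0 <= t * m * (e * e) by rewrite mulr_ge0 // mulr_ge0 // ltW.
    lra.
  by apply: ler_pM => //; try lra; apply: mulr_ge0 => //; lra.
have m2e : 0 < m * (1 - 2 * e) by apply: mulr_gt0; lra.
have rhoE : rho * l = (1 + e) * l / (m * (1 - 2 * e)).
  by rewrite /rho; field; apply/andP; split; lra.
have v0 : 0 <= v (x - c) by have /andP[] := tv.2 (x - c).
have [v2l|v2l] := leP (v (x - c)) (2 * l); last first.
  have := bound (2 * l) _ (ltW v2l) ml_small; rewrite mulr_ge0 // => /(_ isT) h.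
  have m_big : 1 <= m * (1 - 2 * e).
    have e1 : 0 <= (1 - e) * (1 - 2 * e) by apply: mulr_ge0; lra.
    have : (1 - e) * (1 - 2 * e) <= 1.
      have : 0 <= e * (3 - 2 * e) by apply: mulr_ge0; lra.
      by lra.
    have : 1 <= (1 + e) ^+ 2 by rewrite expr2; have := mulr_ge0 (ltW e_gt0) (ltW e_gt0); lra.
    move=> h1 h2.
    have h3 : (1 - e) * (1 - 2 * e) * (m * (1 - 2 * e)) <= 1 * (m * (1 - 2 * e)).
      by apply: ler_wpM2r; [exact: ltW|].
    have := em; rewrite (expr2 (1 - 2 * e)); lra.
  have l0 : l = 0.
    apply/eqP; rewrite eq_le l_ge0 andbT.
    have : 2 * l * 1 <= 2 * l * (m * (1 - 2 * e)).
      by apply: ler_wpM2l => //; rewrite mulr_ge0.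
    have : e * l <= 4^-1 * l by apply: ler_wpM2r.
    by lra.
  by move: flat; rewrite l0 mulr0 ltNge; have /andP[-> _] := tu.2 (x - M).
rewrite rhoE ler_pdivlMr //; apply: bound => //.
apply: le_trans ml_small; apply: ler_wpM2r => //; lra.
Qed.

Let rho_le1 : rho <= 1.
Proof.
params; have p : 0 < (1 - 2 * e) * m by apply: mulr_gt0; lra.
rewrite /rho ler_pdivrMr // mul1r leNgt; apply/negP => hm.
have h1 : (1 - e) * (1 - 2 * e) * ((1 - 2 * e) * m) <= (1 - e) * (1 - 2 * e) * (1 + e).
  by apply: ler_wpM2l; [apply: mulr_ge0; lra|exact: ltW].
have e1 : (1 - e) * (1 - 2 * e) < 1 + e.
  have : 0 <= e * (4^-1 - e) by apply: mulr_ge0; lra.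
  by lra.
have h2 : (1 - e) * (1 - 2 * e) * (1 + e) < (1 + e) * (1 + e).
  by rewrite ltr_pM2r //; lra.
by move: (em); rewrite !expr2; lra.
Qed.

Let m_rho : m * rho ^+ 2 <= 1 - e.
Proof.
params; have p : 0 < (1 - 2 * e) ^+ 2 * m by rewrite mulr_gt0 ?exprn_gt0 //; lra.
have -> : m * rho ^+ 2 = (1 + e) ^+ 2 / ((1 - 2 * e) ^+ 2 * m).
  by rewrite /rho; field; apply/andP; split; lra.
by rewrite ler_pdivrMr // mulrA.
Qed.

Let a_le y : y <= c -> a y <= rho * l.
Proof. by move=> yc; apply: le_trans a_le_rho; apply: tv.1; lra. Qed.

Let f_ge0 t : 0 <= t -> 0 <= f t.
Proof. by move=> t0; rewrite /f mulr_ge0 // loss_ge0. Qed.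

Let f_mono s t : 0 <= s -> s <= t -> f s <= f t.
Proof.
move=> s0 st; rewrite /f; have [ls|ls] := ltP l s.
  by rewrite (lt_le_trans ls st) !mulr1; exact: loss_mono.
by rewrite mulr0 f_ge0 // (le_trans s0).
Qed.

Let ba : bounded_ge0 a. Proof. exact: bounded_ge0_tail_fun. Qed.
Let bb : bounded_ge0 b. Proof. exact: bounded_ge0_tail_fun. Qed.

Let bf (g : R -> R) : bounded_ge0 g -> bounded_ge0 (fun y => f (g y)).
Proof.
move=> bg; apply: bounded_ge0M; first exact: bounded_ge0_loss.
by apply: bounded_ge0_bool; apply: measurable_fun_ltr => //; case: bg.
Qed.

Let bH : bounded_ge0 (fun y => b y * (2 * a y <= b y)%R%:R).
Proof.
apply: bounded_ge0M => //; apply: bounded_ge0_bool.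
apply: measurable_fun_ler; last by case: bb.
by apply: measurable_funM => //; case: ba.
Qed.

Let H_ge0 : 0 <= H. Proof. exact: mean_ge0. Qed.
Let L_ge0 : 0 <= L. Proof. by apply: mean_ge0; exact: bf. Qed.

(** [f (a y)] vanishes for [y <= c], so shortening jumps by [M] gains a factor [q] and turns [a]
    into [b]. Where [b] doubles [a], the loss at [b] is charged to [H]; elsewhere to four times the
    loss at [a], which is [4 * f] above level [l] and at most [4 * kap * l ^+ 2] below it. *)
Let L_le : L <= 2 * q * (e * H + 4 * kap * l ^+ 2).
Proof.
params.
have hshift : L <= q * mean mu (fun y => f (b y)).
  have -> : (fun y => f (b y)) = (fun y => f (a (y + M))).
    by apply/funext => y; rewrite /a /b; congr (f (v _)); lra.
  apply: (mean_shift_le _ (fun y => f (a y)) c) => //.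
  - by rewrite /M; lra.
  - exact: bf.
  - move=> y z yz; apply: f_mono; first by have /andP[] := a01 y.
    by apply: tv.1; lra.
  - move=> y yc; rewrite /f ltNge (le_trans (a_le y yc)) ?mulr0 //.
    by rewrite ler_piMl.
have hb : mean mu (fun y => f (b y)) <= e * H + 4 * kap * l ^+ 2 + 4 * L.
  have kl : 0 <= 4 * kap * l ^+ 2 by rewrite !mulr_ge0 ?sqr_ge0 // ltW.
  have bfa := bf _ ba.
  have b1 : bounded_ge0 (fun y => e * (b y * (2 * a y <= b y)%R%:R)).
    by apply: bounded_ge0Z => //; exact: ltW.
  have b2 : bounded_ge0 (fun y => 4 * f (a y)) by apply: bounded_ge0Z.
  have b3 : bounded_ge0 (fun=> 4 * kap * l ^+ 2) by exact: bounded_ge0_cst.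
  have b4 := bounded_ge0D _ _ b1 b3.
  have -> : e * H + 4 * kap * l ^+ 2 + 4 * L = mean mu (fun y =>
      e * (b y * (2 * a y <= b y)%R%:R) + 4 * kap * l ^+ 2 + 4 * f (a y)).
    by have e0 := ltW e_gt0; rewrite !meanD // mean_cst !meanZ.
  apply: mean_le; [exact: bf|exact: bounded_ge0D|].
  move=> y; have /andP[a0 _] := a01 y; have /andP[b0 _] := b01 y.
  have fa := f_ge0 _ a0.
  have [ab2|ab2] := leP (2 * a y) (b y).
    rewrite mulr1; have : f (b y) <= e * b y.
      rewrite /f; case: (l < b y)%R; rewrite ?mulr1 ?mulr0; first exact: loss_le_lin.
      by rewrite mulr_ge0 // ltW.
    by lra.
  rewrite !mulr0 add0r.
  have hf : f (b y) <= 4 * loss e kap (a y).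
    apply: le_trans (loss_double e kap e_gt0 kap_gt0 _ a0).
    have : loss e kap (b y) <= loss e kap (2 * a y) by apply: loss_mono => //; exact: ltW.
    have := loss_ge0 e kap e_gt0 kap_gt0 _ b0.
    by rewrite /f; case: (l < b y)%R; rewrite ?mulr1 ?mulr0; lra.
  apply: (le_trans hf); rewrite /f; have [la|la] := ltP l (a y).
    by rewrite mulr1; lra.
  rewrite !mulr0 addr0 -mulrA ler_pM2l //; apply: (le_trans (loss_le_sqr _ _ _)).
  by rewrite ler_pM2l // lerXn2r // nnegrE.
have h1 : q * mean mu (fun y => f (b y)) <= q * (e * H + 4 * kap * l ^+ 2 + 4 * L).
  by apply: ler_wpM2l.
(* The estimate bounds [L] by itself; [4 * q <= 1/2] absorbs that occurrence. *)
have h2 : q * L <= 8^-1 * L by apply: ler_wpM2r.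
by lra.
Qed.

(** Averaging [at_least_one_flatness] leaves the error [kap * l ^+ 2] multiplied by
    [m * rho ^+ 2 <= 1 - e]. Half of the room [e * kap * l ^+ 2] pays for the squares, half for the
    terms in [q]; the rest of [L] is covered by [H]. *)
Lemma not_flat_at_flat_point :
  (1 + e) * l - kap * l ^+ 2 <= u (x - M).
Proof.
params.
pose eta := (4 * k0%:R)^-1 : R.
have k0R : 1 <= k0%:R :> R by rewrite (ler_nat R 1).
have eta0 : 0 < eta by rewrite invr_gt0; lra.
have l_eta : l <= eta.
  rewrite /eta -[leRHS]div1r ler_pdivlMr; last by lra.
  rewrite -(ler_pM2l e_gt0) mulr1.
  have : e * (4 * k0%:R) * l <= kap * l by apply: ler_wpM2r.
  by move: (kap_l); lra.
have l1 : l <= 1 by have /andP[] := tu.2 x.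
have bfa := bf _ ba.
have bl : bounded_ge0 (fun y => loss e kap (a y)) by exact: bounded_ge0_loss.
have be : bounded_ge0 (fun y => 8^-1 * (eta < a y)%R%:R).
  apply: bounded_ge0Z => //; apply: bounded_ge0_bool.
  by apply: measurable_fun_ltr => //; case: ba.
have ba2 : bounded_ge0 (fun y => 2 * e * a y ^+ 2).
  apply: bounded_ge0Z; first by rewrite mulr_ge0 // ltW.
  by under eq_fun do rewrite expr2; exact: bounded_ge0M.
have bH8 : bounded_ge0 (fun y => 8^-1 * (b y * (2 * a y <= b y)%R%:R)).
  exact: bounded_ge0Z.
have b0 := @bounded_ge0_cst R 0 (lexx 0).
have e2 : e <= 2^-1 by lra.
have := step (1 + e) 1 0 x (x - M) k0 _ _ _ _ _ ler01 (lexx 0) k0_gt0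
  bH8 (bounded_ge0D _ _ bl be) ba2 b0.
have -> : 0 <= 1 + e by lra.
rewrite mean_cst mulr0 !addr0 mul1r => /(_ isT) main.
have {main} main : (1 + e) * l + (1 - m1 / k0%:R) * (8^-1 * H) <=
    u (x - M) + m * mean mu (fun y => loss e kap (a y) + 8^-1 * (eta < a y)%R%:R) +
    m1 * mean mu (fun y => 2 * e * a y ^+ 2).
  rewrite -meanZ //; apply: main => k y k_gt0.
  have -> : \sum_(i < k) (0 : R) = 0 by rewrite big1.
  rewrite mul1r !addr0.
  apply: (at_least_one_flatness e kap e_gt0 e2 kap_gt0 k k0 (fun i => a (y i)) (fun i => b (y i))) => //.
  by move=> i; rewrite /a /b; have := v_not_flat (x - y i); rewrite addrAC.
have b1 := @bounded_ge0_cst R (kap * (rho * l) ^+ 2) (mulr_ge0 (ltW kap_gt0) (sqr_ge0 _)).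
have kl0 : 0 <= kap * l ^+ 2 by rewrite mulr_ge0 ?sqr_ge0 // ltW.
have b2 := bounded_ge0Z _ _ kl0 (bounded_ge0_gt c).
have w0 : 0 <= 1 + (8 * (e * eta))^-1.
  by rewrite addr_ge0 // invr_ge0 mulr_ge0 // mulr_ge0 // ltW.
have b3 := bounded_ge0Z _ _ w0 bfa.
(* Three kinds of jumps: [y <= c], where [a y <= rho * l]; longer ones with [a y <= l], of
   probability at most [q]; and those with [a y > l], counted in [L]. *)
have hf1 : mean mu (fun y => loss e kap (a y) + 8^-1 * (eta < a y)%R%:R) <=
    kap * (rho * l) ^+ 2 + kap * l ^+ 2 * q + (1 + (8 * (e * eta))^-1) * L.
  apply: (@le_trans _ _ (mean mu (fun y => kap * (rho * l) ^+ 2 +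
      kap * l ^+ 2 * (c < y)%R%:R + (1 + (8 * (e * eta))^-1) * f (a y)))); last first.
    rewrite meanD //; last exact: bounded_ge0D.
    rewrite meanD // mean_cst !meanZ //; last exact: bounded_ge0_gt.
    rewrite mean_gt -/L lerD2r lerD2l ler_wpM2l //.
    have := tail 0 (lexx 0); rewrite add0r => h; apply: (le_trans h).
    by rewrite ler_piMr // upper_tail_le1.
  apply: mean_le; [exact: bounded_ge0D|by apply: bounded_ge0D => //; exact: bounded_ge0D|].
  move=> y; have /andP[a0 a1] := a01 y.
  have fa := f_ge0 _ a0; have wf := mulr_ge0 w0 fa.
  have hl := loss_le_sqr e kap (a y).
  have kr0 : 0 <= kap * (rho * l) ^+ 2 by rewrite mulr_ge0 ?sqr_ge0 // ltW.
  have [la|al] := ltP l (a y); last first.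
    have -> : (eta < a y)%R = false by rewrite ltNge (le_trans al).
    rewrite mulr0 addr0; have [cy|yc] := ltP c y.
      rewrite mulr1; have : kap * a y ^+ 2 <= kap * l ^+ 2.
        by rewrite ler_pM2l // lerXn2r ?nnegrE.
      by lra.
    rewrite mulr0; have : kap * a y ^+ 2 <= kap * (rho * l) ^+ 2.
      by rewrite ler_pM2l // lerXn2r ?nnegrE ?a_le // (le_trans a0) ?a_le.
    by lra.
  have -> : (c < y)%R = true.
    rewrite ltNge; apply/negP => yc; move: la; rewrite ltNge => /negP; apply.
    by apply: (le_trans (a_le _ yc)); rewrite ler_piMl.
  have fE : f (a y) = loss e kap (a y) by rewrite /f la mulr1.
  (* Above [eta] the loss is at least [e * eta], because [kap * eta >= e]. *)
  have ind : 8^-1 * (eta < a y)%R%:R <= (8 * (e * eta))^-1 * f (a y).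
    case: ltP => ea; last by rewrite mulr0 mulr_ge0 // invr_ge0 !mulr_ge0 // ltW.
    rewrite mulr1 fE invfM -mulrA ler_pMr // ler_pdivlMl ?mulr_gt0 // mulr1.
    have ea' : e * eta <= e * a y by rewrite ler_pM2l // ltW.
    rewrite /loss le_min ea' /= expr2 mulrA; apply: (le_trans ea').
    rewrite ler_pM2r; last exact: lt_trans ea.
    apply: (@le_trans _ _ (kap * eta)); last by rewrite ler_pM2l // ltW.
    by rewrite /eta ler_pdivlMr //; lra.
  by rewrite mulr1 fE in ind wf *; lra.
have hf2 : mean mu (fun y => 2 * e * a y ^+ 2) <= 2 * e * l ^+ 2 + 2 * L.
  have c0 : 0 <= 2 * e * l ^+ 2 by rewrite !mulr_ge0 ?sqr_ge0 // ltW.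
  have b4 := bounded_ge0_cst _ c0; have b5 := bounded_ge0Z 2 _ (ler0n _ _) bfa.
  rewrite -[X in X + _](mean_cst mu) -[2 * L]meanZ // -meanD //.
  apply: mean_le => //; first exact: bounded_ge0D.
  move=> y; have /andP[a0 a1] := a01 y.
  have [la|al] := ltP l (a y); last first.
    have : 2 * e * a y ^+ 2 <= 2 * e * l ^+ 2.
      by rewrite ler_wpM2l ?mulr_ge0 // ?lerXn2r ?nnegrE // ltW.
    by have := f_ge0 _ a0; lra.
  have : e * a y ^+ 2 <= f (a y).
    rewrite /f la mulr1 /loss le_min; apply/andP; split.
      by rewrite ler_pM2l // expr2 ler_piMr.
    by rewrite ler_wpM2r ?sqr_ge0 //; lra.
  by lra.
have m_ge0 : 0 <= m by lra.
have h1 : m * mean mu (fun y => loss e kap (a y) + 8^-1 * (eta < a y)%R%:R) <=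
    kap * l ^+ 2 * (1 - e) + kap * l ^+ 2 * (m1 * q) +
    m1 * (1 + (8 * (e * eta))^-1) * L.
  apply: (le_trans (ler_wpM2l m_ge0 hf1)).
  rewrite 2!(mulrDr m); apply: lerD; first apply: lerD.
  - have -> : m * (kap * (rho * l) ^+ 2) = kap * l ^+ 2 * (m * rho ^+ 2) by ring.
    by rewrite ler_wpM2l.
  - by rewrite mulrCA ler_wpM2l // ler_wpM2r.
  - rewrite (mulrA m); apply: ler_wpM2r => //.
    exact: ler_wpM2r.
have h2 : m1 * mean mu (fun y => 2 * e * a y ^+ 2) <= m1 * (2 * e * l ^+ 2 + 2 * L).
  by rewrite ler_wpM2l //; lra.
have C3E : C3 = m1 * (1 + (8 * (e * eta))^-1) + 2 * m1.
  by rewrite /C3 /eta; field; apply/andP; split; lra.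
have hC : C3 * L <= H / 16 + kap * l ^+ 2 * (8 * q * C3).
  have C3_ge0 : 0 <= C3.
    by rewrite C3E addr_ge0 // mulr_ge0 //; lra.
  apply: (le_trans (ler_wpM2l C3_ge0 L_le)).
  have : C3 * (2 * q * e) * H <= 16^-1 * H by apply: ler_wpM2r.
  by lra.
(* The nonlinearity costs [2 * e * m1 * l ^+ 2], hence the requirement [kap >= 4 * m1]. *)
have hm : 2 * e * m1 * l ^+ 2 <= kap * l ^+ 2 * (e / 2).
  have : e * l ^+ 2 * (4 * m1) <= e * l ^+ 2 * kap.
    by rewrite ler_wpM2l // mulr_ge0 ?sqr_ge0 // ltW.
  by lra.
have hq : kap * l ^+ 2 * (m1 * q + 8 * q * C3) <= kap * l ^+ 2 * (e / 2).
  by rewrite ler_wpM2l.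
have hH : H / 16 <= (1 - m1 / k0%:R) * (8^-1 * H).
  have : m1 / k0%:R <= 2^-1.
    by rewrite ler_pdivrMr; [move: (k0_ge); lra|lra].
  move=> hk; have : 2^-1 * (8^-1 * H) <= (1 - m1 / k0%:R) * (8^-1 * H).
    by rewrite ler_wpM2r ?mulr_ge0 //; lra.
  by lra.
by rewrite C3E in hC hq; lra.
Qed.

End step.

Lemma not_flat_step u v : tail_fun u -> tail_fun v ->
  branching_step mu m m1 u v -> not_flat v -> not_flat u.
Proof.
move=> tu tv step v_not_flat x.
have [flat|nflat] := ltP (u (x - M)) ((1 + e) * u x); last first.
  apply: le_trans nflat; rewrite gerBl mulr_ge0 ?sqr_ge0 //.
  by params; lra.
(* When [kap * u x > e] the quadratic term outweighs the growth and monotonicity of [u] suffices. *)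
have [kl|kl] := leP (kap * u x) e.
  exact: (not_flat_at_flat_point u v).
have u0 : 0 <= u x by have /andP[] := tu.2 x.
have : u x <= u (x - M) by apply: tu.1; params; rewrite /M; lra.
have : u x * e <= u x * (kap * u x) by rewrite ler_wpM2l // ltW.
by rewrite expr2; lra.
Qed.

End flatness.

(** * Uniform decay and spread of the tails *)

Lemma exp_tail_small {R : realType} (a M0 z : R) : 0 < a -> 0 < M0 -> 0 < z ->
  exists2 M, M0 < M & expR (- (a * M)) <= z.
Proof.
move=> a0 M00 z0; exists (M0 + 1 + `|ln z| / a); first by rewrite -addrA ltrDl ltr_wpDr // divr_ge0 // ltW.
rewrite -[leRHS]lnK ?posrE // ler_expR.
have -> : a * (M0 + 1 + `|ln z| / a) = a * (M0 + 1) + `|ln z| by field; lra.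
have : 0 <= a * (M0 + 1) by rewrite mulr_ge0 //; lra.
by have := ler_norm (- ln z); rewrite normrN; lra.
Qed.

Section uniform_spread.
Context {R : realType}.
Variables (mu : nat -> probability R R) (m : nat -> R) (m0 m1 a M0 : R).
Variable u : nat -> nat -> R -> R.
Hypotheses (m0_gt1 : 1 < m0) (m_ge : forall s, m0 <= m s) (m_le : forall s, m s <= m1).
Hypotheses (a_gt0 : 0 < a) (M0_gt0 : 0 < M0).
Hypothesis right_tail : forall s t M, M0 < M -> 0 <= t ->
  upper_tail (mu s) (t + M) <= expR (- (a * M)) * upper_tail (mu s) t.
Hypothesis left_tail : forall eta : R, 0 < eta -> exists2 B : R, 0 < B &
  forall s, 1 - eta <= upper_tail (mu s) (- B).
Hypothesis tu : forall s r, tail_fun (u s r).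
Hypothesis u0 : forall s x, u s 0 x = (x < 0)%R%:R.
Hypothesis step : forall s r,
  branching_step (mu s) (m s) m1 (u s r.+1) (u s.+1 r).

Let m1_gt1 : 1 < m1.
Proof. by apply: lt_le_trans m0_gt1 _; apply: le_trans (m_ge 0%N) (m_le 0%N). Qed.

(** To first order [em] asks for [1 + 3 * e <= (1 - 5 * e) * m0]; this follows from
    [8 * m0 * e = m0 - 1]. *)
Let e := (m0 - 1) / (8 * m0).

Let e_gt0 : 0 < e.
Proof. by have hm0 := m0_gt1; rewrite divr_gt0 //; lra. Qed.

Let e_le : e <= 8^-1.
Proof. by have hm0 := m0_gt1; rewrite ler_pdivrMr; lra. Qed.

Let em s : (1 + e) ^+ 2 <= (1 - e) * (1 - 2 * e) ^+ 2 * m s.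
Proof.
have h := m0_gt1; have e0 := e_gt0; have e8 := e_le.
have em0 : 8 * m0 * e = m0 - 1 by rewrite /e; field; lra.
have ee : 0 <= e * e by rewrite mulr_ge0 // ltW.
have ee8 : e * e <= 8^-1 * e by rewrite ler_wpM2r // ltW.
have h1 : (1 + e) ^+ 2 <= 1 + 3 * e by rewrite expr2; lra.
have h2 : 1 - 5 * e <= (1 - e) * (1 - 2 * e) ^+ 2.
  have : e * (e * e) <= e * e by rewrite ler_piMl //; lra.
  have -> : (1 - e) * (1 - 2 * e) ^+ 2 = 1 - 5 * e + 8 * (e * e) - 4 * (e * (e * e)) by ring.
  by lra.
apply: (le_trans h1); apply: (@le_trans _ _ ((1 - 5 * e) * m0)).
  have : 3 * e <= 3 * e * m0 by apply: ler_peMr; lra.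
  by lra.
by apply: ler_pM => //; lra.
Qed.

(** The shift in [not_flat] is a sum of two lengths; here it is given whole, with 0 as the second.
    At [r = 0] the tail is a step function and the inequality is immediate. *)
Lemma uniformly_not_flat : exists M kap : R, [/\ 0 < M, 4 * m1 <= kap &
  forall s r, not_flat e M 0 kap (u s r)].
Proof.
have h := m0_gt1; have hm1 := m1_gt1; have e0 := e_gt0; have e8 := e_le.
pose k0 := (Num.bound (2 * m1)).+1.
have k0_ge : 2 * m1 <= k0%:R.
  rewrite ltW // (lt_le_trans (archi_boundP _)) ?ler_nat //.
  by rewrite mulr_ge0 // ltW // (lt_trans ltr01).
have k0R : 0 < k0%:R :> R by rewrite ltr0n.
pose C3 := 3 * m1 + m1 * k0%:R / (2 * e).
have C3_gt0 : 0 < C3.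
  apply: addr_gt0; first by lra.
  by apply: divr_gt0; [apply: mulr_gt0 => //; lra|lra].
have [B B_gt0 left] := left_tail e e_gt0.
(* The three bounds are the smallness conditions on [q] required by [not_flat_step]. *)
pose z := Num.min 8^-1 (Num.min (32 * e * C3)^-1 (e / (2 * (m1 + 8 * C3)))).
have z_gt0 : 0 < z.
  rewrite !lt_min; apply/and3P; split; first by lra.
    by rewrite invr_gt0 mulr_gt0 // mulr_gt0.
  by rewrite divr_gt0 // mulr_gt0 //; lra.
have [c c_gt q_le] := exp_tail_small a M0 z a_gt0 M0_gt0 z_gt0.
set q := expR _ in q_le.
have q_ge0 : 0 <= q by exact: expR_ge0.
move: q_le; rewrite !le_min => /and3P[q1 q2 q3].
have c_gt0 : 0 < c by exact: lt_trans c_gt.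
pose kap := e * (4 * k0%:R) + 4 * m1.
have ek : 0 < e * (4 * k0%:R) by rewrite mulr_gt0 // mulr_gt0.
exists (c + B), kap; split; first by rewrite addr_gt0.
  by rewrite /kap lerDr ltW.
move=> s r; elim: r s => [|r IH] s.
  move=> x; rewrite !u0; case: ltP => x0; last first.
    by rewrite mulr0 expr0n mulr0 subrr; case: (_ < _)%R; rewrite ?ler01.
  have -> : (x - (c + B + 0) < 0)%R = true by apply/idP; lra.
  have -> : true%:R = 1 :> R by [].
  by rewrite expr1n !mulr1 /kap; lra.
rewrite /not_flat addr0.
apply: (not_flat_step (mu s) (m s) m1 e c B q kap k0 _ _ _ _ _ (m_le s) _ q1
  (em s) (left s) _ _ k0_ge _ _ _ _ (u s r.+1) (u s.+1 r) (tu _ _) (tu _ _) (step _ _)) => //.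
- lra.
- by have := m_ge s; lra.
- by move=> t t0; apply: right_tail.
- rewrite -/C3; move: q2; rewrite -[leRHS]div1r ler_pdivlMr; last by rewrite mulr_gt0 // mulr_gt0.
  by lra.
- rewrite -/C3; move: q3; rewrite ler_pdivlMr; last by rewrite mulr_gt0 //; lra.
  by lra.
- by rewrite /kap; lra.
- by rewrite /kap; lra.
- by move=> x; have := IH s.+1 x; rewrite addr0.
Qed.

Let spread (l1 l2 : R) := exists2 L : R, 0 <= L &
  forall s r x, l1 <= u s r x -> l2 <= u s r (x - L).

(** Below [e / (2 * kap)] the quadratic error is at most half of the growth, so each shift by [M]
    multiplies the tail by at least [1 + e / 2]. *)
Lemma spread_small : exists2 de : R, 0 < de <= 4^-1 &
  forall l1, 0 < l1 -> spread l1 de.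
Proof.
have hm1 := m1_gt1; have e0 := e_gt0; have e8 := e_le.
have [M [kap [M_gt0 kap_ge nf]]] := uniformly_not_flat.
have kap_gt0 : 0 < kap by lra.
pose de := e / (2 * kap).
exists de.
  have k2 : 0 < 2 * kap by rewrite mulr_gt0.
  by rewrite /de divr_gt0 //= ler_pdivrMr //; lra.
move=> l1 l1_gt0.
(* Growth by at least [l1 * (e / 2)] per shift is enough to reach [de] in a number of shifts
   depending only on [l1]. *)
have grow j s r x : l1 <= u s r x ->
    Num.min de (l1 * (1 + j%:R * (e / 2))) <= u s r (x - j%:R * M).
  move=> l1u; elim: j => [|j IH].
    by rewrite !mul0r subr0 addr0 mulr1 ge_min l1u orbT.
  have -> : x - j.+1%:R * M = x - j%:R * M - M by rewrite -natr1; ring.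
  set y := x - j%:R * M in IH *.
  have uy1 : l1 <= u s r y.
    apply: (le_trans l1u); apply: (tu s r).1; rewrite /y gerBl mulr_ge0 ?ler0n //.
    exact: ltW.
  have uyM : u s r y <= u s r (y - M) by apply: (tu s r).1; lra.
  have [du|ud] := leP de (u s r y); first by rewrite ge_min (le_trans du).
  rewrite ge_min; apply/orP; right.
  move: IH; rewrite ge_min leNgt ud /= => IH.
  have := nf s r y; rewrite addr0.
  have : kap * u s r y ^+ 2 <= e / 2 * u s r y.
    rewrite expr2 mulrA ler_pM2r ?(lt_le_trans l1_gt0) //.
    by move: ud; rewrite /de ltr_pdivlMr; lra.
  have : e * l1 <= e * u s r y by rewrite ler_pM2l.
  by rewrite -[j.+1%:R]natr1; lra.
pose j := Num.bound (de / (l1 * (e / 2))).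
exists (j%:R * M); first by rewrite mulr_ge0 ?ler0n // ltW.
move=> s r x /(grow j); apply: le_trans; rewrite le_min lexx /=.
have de_gt0 : 0 < de by rewrite divr_gt0 // mulr_gt0.
have le_gt0 : 0 < l1 * (e / 2) by rewrite mulr_gt0 // divr_gt0.
have := archi_boundP (divr_ge0 (ltW de_gt0) (ltW le_gt0)); rewrite -/j.
by rewrite ltr_pdivrMr //; lra.
Qed.

(** Union bound over the children: those jumping beyond [B] contribute at most half of [l1], so the
    others force the tail one generation later to be large. *)
Lemma spread_down (l1 : R) : 0 < l1 -> exists2 B : R, 0 < B &
  forall s r x, l1 <= u s r.+1 x -> l1 / (2 * m1) <= u s.+1 r (x - B).
Proof.
move=> l1_gt0; have hm1 := m1_gt1.
have z_gt0 : 0 < l1 / (2 * m1) by rewrite divr_gt0 //; lra.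
have [B B_gt qB] := exp_tail_small a M0 _ a_gt0 M0_gt0 z_gt0.
exists B; first exact: lt_trans B_gt.
move=> s r x l1u; set v := u s.+1 r.
have v_ge0 : 0 <= v (x - B) by have /andP[] := (tu s.+1 r).2 (x - B).
have bc := bounded_ge0_cst _ v_ge0; have bg := bounded_ge0_gt B.
have b0 := @bounded_ge0_cst R 0 (lexx 0).
have := step s r 1 0 0 x x 1%N _ _ _ _ ler01 (lexx 0) (lexx 0) isT
  b0 (bounded_ge0D _ _ bg bc) b0 b0.
rewrite -/v !mean_cst !mulr0 !addr0 mul1r mul0r !add0r => h.
have {h} : u s r.+1 x <= m s * (upper_tail (mu s) B + v (x - B)).
  rewrite -mean_gt -(mean_cst (mu s) (v (x - B))) -meanD //; apply: h => k y k_gt0.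
  have -> : \sum_(i < k) (0 : R) = 0 by rewrite big1.
  rewrite mul1r mul0r !mulr0 !addr0 add0r.
  apply: (le_trans (at_least_one_le_sum _ _ _)); first by move=> i; exact: (tu s.+1 r).2.
  apply: ler_sum => i _; have /andP[v0 v1] := (tu s.+1 r).2 (x - y i).
  case: ltP => By.
    have -> : true%:R = 1 :> R by [].
    by rewrite -/v in v0 v1 *; lra.
  by rewrite add0r; apply: (tu s.+1 r).1; lra.
have tB : upper_tail (mu s) B <= l1 / (2 * m1).
  have := right_tail s 0 B B_gt (lexx 0); rewrite add0r => ht.
  apply: (le_trans ht); apply: le_trans qB; rewrite ler_piMr ?expR_ge0 //.
  exact: upper_tail_le1.
move=> hu; have {hu} hu := le_trans l1u hu.
have {hu} : l1 <= m1 * (l1 / (2 * m1) + v (x - B)).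
  apply: (le_trans hu); apply: ler_pM => //.
  - by have := m_ge s; have := m0_gt1; lra.
  - by rewrite addr_ge0 // upper_tail_ge0.
  - by rewrite lerD2r.
have -> : m1 * (l1 / (2 * m1) + v (x - B)) = l1 / 2 + m1 * v (x - B) by field; lra.
move=> hu; rewrite ler_pdivrMr; last by lra.
lra.
Qed.

(** One branching raises an intermediate level by a definite amount, since more than one child is
    born on average and [t * (1 - t)] is bounded below for [de <= t <= 1 - la]. *)
Lemma spread_up (de la : R) : 0 < de -> 0 < la -> exists B c : R, [/\ 0 < B, 0 < c &
  forall s r x t, de <= t -> t <= 1 - la -> t <= u s.+1 r x ->
    t + c <= u s r.+1 (x - B)].
Proof.
move=> de_gt0 la_gt0; have hm0 := m0_gt1; have hm1 := m1_gt1.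
(* The surplus is [4 * D]: one [D] pays for jumps below [-B], one for the second moment term
   ([m1 / A = D]), one for the two losses [w] of the first-child term, and the last is the gain. *)
pose D := (m0 - 1) / 4; have D_gt0 : 0 < D by rewrite divr_gt0 // subr_gt0.
pose A := m1 / D; have A_gt0 : 0 < A by rewrite divr_gt0 //; lra.
pose eta := Num.min (D / m0) (la * D / (2 * A)).
have laDA : 0 < la * D / (2 * A) by apply: divr_gt0; rewrite mulr_gt0.
have eta_gt0 : 0 < eta by rewrite lt_min laDA divr_gt0 //; lra.
have [B B_gt0 left] := left_tail eta eta_gt0.
pose k0 := (Num.bound (m1 / (la * D / (2 * A)))).+1.
have k0R : 0 < k0%:R :> R by rewrite ltr0n.
have k0_ge : m1 / k0%:R <= la * D / (2 * A).
  rewrite ler_pdivrMr // mulrC -ler_pdivrMr //.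
  rewrite ltW // (lt_le_trans (archi_boundP _)) ?ler_nat //.
  by rewrite divr_ge0 // ltW // (lt_trans ltr01).
have c_gt0 : 0 < de * (la * D / A) by rewrite mulr_gt0 // divr_gt0 // mulr_gt0.
exists B, (de * (la * D / A)); split => // s r x t t_ge t_le tv.
have t_gt0 : 0 < t by exact: lt_le_trans t_ge.
have t1 : 0 < 1 - t by lra.
have tt0 : 0 <= t * (1 - t) by rewrite mulr_ge0 // ltW.
set v := u s.+1 r in tv.
have bg := bounded_ge0_gt (- B); have b0 := @bounded_ge0_cst R 0 (lexx 0).
have bt := bounded_ge0Z t _ (ltW t_gt0) bg.
have ttA0 : 0 <= t * (1 - t) / A by rewrite divr_ge0 // ltW.
have := step s r 0 A (t * (1 - t)) x (x - B) k0 _ _ _ _ (lexx 0) (ltW A_gt0) tt0 isT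
  (bounded_ge0Z A _ (ltW A_gt0) bt) b0 (bounded_ge0Z (t * (1 - t) / A) _ ttA0 bg)
  (bounded_ge0Z (t * (1 - t)) _ tt0 bg).
rewrite -/v !mean_cst mulr0 addr0 mul0r add0r => h.
set ga := upper_tail (mu s) (- B).
have {h} h : (1 - m1 / k0%:R) * (A * (t * ga)) + m s * (t * (1 - t) * ga) <=
    A * u s r.+1 (x - B) + t * (1 - t) + m1 * (t * (1 - t) / A * ga).
  have E1 : mean (mu s) (fun y => A * (t * (- B < y)%R%:R)) = A * (t * ga).
    rewrite meanZ //; last exact: ltW.
    by rewrite meanZ // ?mean_gt // ltW.
  have E2 : mean (mu s) (fun y => t * (1 - t) * (- B < y)%R%:R) = t * (1 - t) * ga.
    by rewrite meanZ // mean_gt.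
  have E3 : mean (mu s) (fun y => t * (1 - t) / A * (- B < y)%R%:R) = t * (1 - t) / A * ga.
    by rewrite meanZ // mean_gt.
  rewrite -E1 -E2 -E3; apply: h => k y k_gt0.
  have -> : \sum_(i < k) (0 : R) = 0 by rewrite big1.
  rewrite mul0r add0r addr0.
  pose sg i := (- B < y i)%R.
  have t01 : 0 <= t <= 1 by rewrite ltW //=; lra.
  have := at_least_one_growth k A t sg k_gt0 A_gt0 t01.
  have : at_least_one k (fun i => t * (sg i)%:R) <=
      at_least_one k (fun i => v (x - B - y i)).
    have v01 := (tu s.+1 r).2; rewrite -/v in v01.
    apply: at_least_one_le => [i|i|i].
    - by case: (sg i); rewrite ?mulr1 ?mulr0 ?lexx ?ler01.
    - exact: v01.
    - rewrite /sg; case: ltP => yB; last by rewrite mulr0; have /andP[] := v01 (x - B - y i).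
      by rewrite mulr1 (le_trans tv) //; apply: (tu s.+1 r).1; lra.
  rewrite -(ler_pM2l A_gt0) => h1.
  rewrite -[\sum_(i < k) (t * (1 - t) * _)]mulr_sumr.
  have : (k <= k0)%N%:R * (A * (t * (sg 0%N)%:R)) <= A * (t * (sg 0%N)%:R).
    rewrite ler_piMl //; last by case: (k <= k0)%N.
    by apply: mulr_ge0; [exact: ltW|apply: mulr_ge0; [exact: ltW|exact: ler0n]].
  by rewrite /sg; lra.
have ga_le1 : ga <= 1 by exact: upper_tail_le1.
have := left s; rewrite -/ga => ga_ge.
have : eta <= D / m0 by rewrite ge_min lexx.
rewrite ler_pdivlMr => [eta1|]; last by lra.
have eta2 : eta <= la * D / (2 * A) by rewrite ge_min lexx orbT.
have ga_ge0 : 0 <= ga by exact: upper_tail_ge0.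
have h1 : m1 * (t * (1 - t) / A * ga) <= t * (1 - t) * D.
  have -> : m1 * (t * (1 - t) / A * ga) = t * (1 - t) * D * ga.
    by rewrite /A; field; apply/andP; split; lra.
  by rewrite ler_piMr // mulr_ge0 // ltW.
have h2 : t * (1 - t) * (1 + 3 * D) <= m s * (t * (1 - t) * ga).
  rewrite [leRHS]mulrCA; apply: ler_wpM2l => //.
  apply: (@le_trans _ _ (m0 * ga)); last by rewrite ler_wpM2r.
  have : m0 * (1 - eta) <= m0 * ga by rewrite ler_wpM2l //; lra.
  have : m0 = 1 + 4 * D by rewrite /D; lra.
  by lra.
set w := la * D / (2 * A) in k0_ge eta2 laDA.
have h3 : A * t * (1 - 2 * w) <= (1 - m1 / k0%:R) * (A * (t * ga)).
  have -> : (1 - m1 / k0%:R) * (A * (t * ga)) = A * t * ((1 - m1 / k0%:R) * ga) by ring.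
  apply: ler_wpM2l; first exact: mulr_ge0 (ltW A_gt0) (ltW t_gt0).
  have : m1 / k0%:R * ga <= m1 / k0%:R by rewrite ler_piMr // divr_ge0 // ltW // (lt_trans ltr01).
  by lra.
have h4 : A * (2 * w) = la * D by rewrite /w; field; lra.
have h5 : t * (la * D) <= t * ((1 - t) * D).
  by rewrite ler_pM2l // ler_pM2r //; lra.
have h6 : A * (de * (la * D / A)) <= t * (la * D).
  have -> : A * (de * (la * D / A)) = de * (la * D) by field; lra.
  by rewrite ler_wpM2r // mulr_ge0 // ltW.
have h7 : A * t * (1 - 2 * w) = A * t - t * (la * D) by rewrite -h4; ring.
suff : A * (t + de * (la * D / A)) <= A * u s r.+1 (x - B) by rewrite ler_pM2l.
by rewrite [leLHS]mulrDr; lra.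
Qed.

(** To gain [j] increments [c], go down [j] generations, where the level is still bounded below,
    spread there up to [de], and come back up, gaining [c] per generation. The number of generations
    is bounded, hence so is the total shift. *)
Theorem uniform_spread (la : R) : 0 < la -> la <= 2^-1 -> exists L : R,
  forall s r x, la <= u s r x -> 1 - la <= u s r (x - L).
Proof.
move=> la_gt0 la_le; have hm1 := m1_gt1.
have [de /andP[de_gt0 de_le] small] := spread_small.
have [B [c [B_gt0 c_gt0 up]]] := spread_up de la de_gt0 la_gt0.
have reach j : forall l1, 0 < l1 -> spread l1 (Num.min (de + j%:R * c) (1 - la)).
  elim: j => [|j IH] l1 l1_gt0.
    have [L L_ge0 hL] := small l1 l1_gt0; exists L => // s r x /hL; apply: le_trans.
    by rewrite mul0r addr0 ge_min lexx.
  have [B' B'_gt0 down] := spread_down l1 l1_gt0.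
  have z_gt0 : 0 < l1 / (2 * m1) by rewrite divr_gt0 //; lra.
  have [L L_ge0 hL] := IH _ z_gt0.
  exists (B' + L + B); first by lra.
  (* With no generation left the tail is 0 or 1, so a positive level is already 1. *)
  move=> s [|r] x l1u.
    rewrite u0; move: l1u; rewrite u0; case: ltP => x0 h; last by move: h; rewrite leNgt l1_gt0.
    have -> : (x - (B' + L + B) < 0)%R = true by apply/idP; lra.
    have -> : true%:R = 1 :> R by [].
    by rewrite ge_min; apply/orP; right; lra.
  have := hL _ _ _ (down _ _ _ l1u).
  set t := Num.min _ _ => ht.
  have -> : x - (B' + L + B) = x - B' - L - B by ring.
  apply: le_trans (up s r _ t _ _ ht).
  - rewrite /t ge_min; case: (leP (de + j%:R * c) (1 - la)) => _; last by lra.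
    by apply/orP; left; rewrite -natr1; lra.
  - rewrite /t le_min; apply/andP; split; last by lra.
    by rewrite lerDl mulr_ge0 ?ler0n // ltW.
  - by rewrite /t ge_min lexx orbT.
(* More than [1 / c] increments exceed 1, so the minimum is [1 - la]. *)
have [L L_ge0 hL] := reach (Num.bound (1 / c)) la la_gt0.
exists L => s r x /hL; apply: le_trans; rewrite le_min lexx andbT.
have := archi_boundP (divr_ge0 ler01 (ltW c_gt0)); rewrite ltr_pdivrMr //.
by lra.
Qed.

End uniform_spread.

(** * Independence of joint sigma-algebras *)

Section independence.
Set Implicit Arguments.
Unset Strict Implicit.
Context d (T : measurableType d) (R : realType) (P : probability T R).
Context (I : eqType) (F : I -> set (set T)).
Hypothesis F_sigma : forall i, sigma_algebra setT (F i).
Hypothesis F_meas : forall i, F i `<=` measurable.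
Hypothesis F_indep : mutually_independent P F.

(** Only a generating family. [joint S] is [T] equipped with the generated sigma-algebra, so
    measurability with respect to it is that of maps from [joint S]. *)
Definition joint_sigma_algebra (S : set I) : set (set T) := \bigcup_(i in S) F i.

Let joint (S : set I) := g_sigma_algebraType (joint_sigma_algebra S).

Let FT i : F i setT.
Proof. by have [F0 FC _] := F_sigma i; rewrite -(setD0 setT); exact: FC. Qed.

Let FI i A B : F i A -> F i B -> F i (A `&` B).
Proof.
move=> FA FB; have sF := F_sigma i.
suff : <<s F i >> (A `&` B) by rewrite sigma_algebra_id.
apply: (@measurableI _ (g_sigma_algebraType (F i))); exact: sub_sigma_algebra.
Qed.

(* Finite cylinders: the sets [f i] are indexed by the whole of [I] but only
   those with [i \in s] are constrained. *)
Definition cylinder (S : set I) : set (set T) := [set A | exists s f,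
  [/\ uniq s, {in s, forall i, S i}, forall i, F i (f i),
      (forall i, i \notin s -> f i = setT) & A = [set w | forall i, f i w]]].

Let cylinder_probability s f : uniq s -> (forall i, F i (f i)) ->
  (forall i, i \notin s -> f i = setT) ->
  P [set w | forall i, f i w] = (\prod_(i <- s) P (f i))%E.
Proof.
move=> us Ff fT; rewrite -(F_indep us) //.
congr (P _); apply/seteqP; split => w /= h i; first by move=> _; exact: h.
by have [/h//|/fT ->] := boolP (i \in s).
Qed.

Let cylinder_setI (S : set I) : setI_closed (cylinder S).
Proof.
move=> _ _ [s [f [us sS Ff fT ->]]] [t [g [ut tS Fg gT ->]]].
exists (undup (s ++ t)), (fun i => f i `&` g i); split.
- exact: undup_uniq.
- by move=> i; rewrite mem_undup mem_cat => /orP[/sS|/tS].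
- by move=> i; exact: FI.
- by move=> i; rewrite mem_undup mem_cat negb_or => /andP[/fT -> /gT ->]; rewrite setIT.
- by apply/seteqP; split => w /=; [move=> [h1 h2] i|move=> h; split=> i; have [] := h i].
Qed.

Let joint_sub_cylinder (S : set I) : <<s joint_sigma_algebra S >> `<=` <<s cylinder S >>.
Proof.
apply: smallest_sub; first exact: smallest_sigma_algebra.
move=> A [i Si FA]; apply: sub_sigma_algebra.
exists [:: i], (fun j => if j == i then A else setT); split => //.
- by move=> j; rewrite inE => /eqP ->.
- by move=> j; case: eqP => [->|_].
- by move=> j; rewrite inE => /negbTE ->.
- apply/seteqP; split => w /= Aw; last by have := Aw i; rewrite eqxx.
  by move=> j; case: eqP.
Qed.

Lemma joint_measurable (S : set I) : <<s joint_sigma_algebra S >> `<=` measurable.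
Proof.
apply: smallest_sub; first exact: sigma_algebra_measurable.
by move=> A [i _]; exact: F_meas.
Qed.

Let cylinder_meas (S : set I) : cylinder S `<=` measurable.
Proof.
move=> _ [s [f [us sS Ff fT ->]]].
have -> : [set w | forall i, f i w] = [set w | forall i, i \in s -> f i w].
  apply/seteqP; split => w /= h i; first by move=> _; exact: h.
  by have [/h//|/fT ->] := boolP (i \in s).
elim: s {us sS fT} => [|j s IH].
  by rewrite [X in measurable X](_ : _ = setT) //; apply/seteqP; split.
have -> : [set w | forall i, i \in j :: s -> f i w] =
    f j `&` [set w | forall i, i \in s -> f i w].
  apply/seteqP; split => w /= h.
    by split=> [|i si]; apply: h; rewrite inE ?eqxx // si orbT.
  by move=> i; rewrite inE => /orP[/eqP ->|]; [case: h|exact: h.2].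
by apply: measurableI => //; exact: F_meas (Ff j).
Qed.

Let cylinderT (S : set I) : cylinder S setT.
Proof.
exists [::], (fun=> setT); split => //.
by apply/seteqP; split.
Qed.

(** Both sides are finite measures in [A], and the cylinders form a generating system closed under
    intersection. *)
Let indep_ext (S : set I) B : measurable B ->
  (forall A, cylinder S A -> P (A `&` B) = (P A * P B)%E) ->
  forall A, <<s joint_sigma_algebra S >> A -> P (A `&` B) = (P A * P B)%E.
Proof.
move=> mB h A /joint_sub_cylinder sA.
have PB0 : 0 <= fine (P B) by exact: fine_ge0.
have PBE : (fine (P B))%:E = P B by rewrite fineK // fin_num_measure.
have scaleE C : mscale (NngNum PB0) P C = (P C * P B)%E.
  by rewrite /mscale /= PBE muleC.
transitivity (mrestr P mB A); first by [].
rewrite -scaleE.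
apply: (@g_sigma_algebra_measure_unique _ R T (cylinder S) _ (fun=> setT)) => //.
- by apply/seteqP; split => // w _; exists 0%N.
- by move=> C cC; rewrite [RHS]scaleE; exact: h.
- by move=> _; change (P (setT `&` B) < +oo)%E; rewrite setTI ltey_eq fin_num_measure.
Qed.

(** Extending from cylinders in each argument in turn leaves two cylinders over disjoint finite
    index sets, for which the product rule is the hypothesis. *)
Lemma joint_independent (S S' : set I) A B : S `&` S' = set0 ->
  <<s joint_sigma_algebra S >> A -> <<s joint_sigma_algebra S' >> B ->
  P (A `&` B) = (P A * P B)%E.
Proof.
move=> SS' sA sB; apply: (@indep_ext S) => //; first exact: joint_measurable sB.
move=> C cC; rewrite setIC muleC; apply: (@indep_ext S') => //; first exact: cylinder_meas cC.
case: cC => s [f [us sS Ff fT ->]] D [t [g [ut tS Fg gT ->]]].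
have st i : i \in s -> i \in t -> False.
  move=> /sS Si /tS S'i; suff : (S `&` S') i by rewrite SS'.
  by [].
rewrite (@cylinder_probability s f) // (@cylinder_probability t g) //.
have -> : [set w | forall i, g i w] `&` [set w | forall i, f i w] =
    [set w | forall i, (g i `&` f i) w].
  by apply/seteqP; split => w /=; [move=> [h1 h2] i|move=> h; split=> i; have [] := h i].
rewrite (@cylinder_probability (t ++ s)).
- rewrite big_cat /=; congr (_ * _)%E; apply: eq_big_seq => i it; congr (P _).
    rewrite -[LHS]/(g i `&` f i) fT ?setIT //.
    by apply/negP => si; exact: st si it.
  rewrite -[LHS]/(g i `&` f i) gT ?setTI //.
  by apply/negP; exact: st.
- rewrite cat_uniq us ut andbT /=; apply/hasPn => i it; apply/negP => /(st i it).
  by [].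
- by move=> i; exact: FI.
- by move=> i; rewrite mem_cat negb_or => /andP[/gT -> /fT ->]; rewrite setIT.
Qed.

Lemma joint_sub (S S' : set I) : S `<=` S' ->
  <<s joint_sigma_algebra S >> `<=` <<s joint_sigma_algebra S' >>.
Proof.
move=> SS'; apply: smallest_sub; first exact: smallest_sigma_algebra.
by move=> A [i Si FA]; apply: sub_sigma_algebra; exists i => //; exact: SS'.
Qed.

Lemma measurable_joint_sub d' (U : measurableType d') (S S' : set I) (f : T -> U) :
  S `<=` S' -> measurable_fun (setT : set (joint S)) (f : joint S -> U) ->
  measurable_fun (setT : set (joint S')) (f : joint S' -> U).
Proof. by move=> SS' mf _ B mB; apply: (joint_sub SS'); exact: mf. Qed.

Lemma measurable_joint d' (U : measurableType d') (S : set I) (f : T -> U) :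
  measurable_fun (setT : set (joint S)) (f : joint S -> U) -> measurable_fun setT f.
Proof. by move=> mf _ B mB; apply: (@joint_measurable S); exact: mf. Qed.

(** The identity into [joint S] carries all information in [S]; paired with [M] its law is a product
    measure, and Tonelli applies. *)
Lemma integral_independent (S S' : set I) (M : T -> R) (phi : T * R -> \bar R) :
  S `&` S' = set0 ->
  measurable_fun (setT : set (joint S')) (M : joint S' -> R) ->
  measurable_fun (setT : set (joint S * R)) (phi : joint S * R -> \bar R) ->
  (forall z, 0 <= phi z)%E ->
  (\int[P]_w phi (w, M w) = \int[P]_w \int[P]_w' phi (w, M w'))%E.
Proof.
move=> SS' mM mphi phi0.
have mid : measurable_fun setT (id : T -> joint S).
  by move=> _ B mB; rewrite setTI; exact: (@joint_measurable S).
have mM' : measurable_fun setT M by exact: measurable_joint mM.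
pose idS : {mfun T >-> joint S} := HB.pack (id : T -> joint S) (isMeasurableFun.Build _ _ _ _ _ mid).
pose M' : {mfun T >-> R} := HB.pack M (isMeasurableFun.Build _ _ _ _ _ mM').
have mpair : measurable_fun setT (fun w : T => (w : joint S, M w)).
  exact: measurable_fun_pair.
pose pair : {mfun T >-> (joint S * R)%type} :=
  HB.pack (fun w : T => (w : joint S, M w)) (isMeasurableFun.Build _ _ _ _ _ mpair).
have prodE : forall X : set (joint S * R), measurable X ->
    (distribution P idS \x distribution P M')%E X = distribution P pair X.
  apply: product_measure_unique => A B mA mB.
  change (P (A `&` M @^-1` B) = (P A * P (M @^-1` B))%E).
  apply: (@joint_independent S S') => //.
  by have := mM measurableT B mB; rewrite setTI.
transitivity (\int[distribution P pair]_z phi z)%E.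
  by rewrite ge0_integral_pushforward.
transitivity (\int[distribution P idS \x distribution P M']_z phi z)%E.
  by apply: eq_measure_integral => /= A mA _; rewrite prodE.
rewrite fubini_tonelli1 //.
rewrite ge0_integral_pushforward //.
- apply: eq_integral => w _; rewrite /= /fubini_F ge0_integral_pushforward //.
  exact: measurable_fun_pair2.
- exact: measurable_fun_fubini_tonelli_F.
- by move=> w _; apply: integral_ge0.
Qed.

End independence.

(** * Maxima of subtrees *)

Section branching_process.
Set Implicit Arguments.
Unset Strict Implicit.
Context d (Omega : measurableType d) (R : realType) (P : probability Omega R).
Variables (p : nat -> nat -> R) (G : nat -> forall k, probability (k.-tuple R) R).
Variables (K : seq nat -> {RV P >-> nat}) (X : seq nat -> nat -> {RV P >-> R}).
Hypothesis gbrw : is_gbrw K X p G.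

Let F := offspring_sigma_algebra K X.
Let joint S := g_sigma_algebraType (joint_sigma_algebra F S).

Lemma measurable_offspring_eq v k : measurable [set w | K v w = k].
Proof.
have := measurable_funP (K v) measurableT [set k] I.
by rewrite setTI; congr measurable; apply/seteqP; split.
Qed.

Lemma offspring_sigma_algebraP v : sigma_algebra setT (F v).
Proof. exact: smallest_sigma_algebra. Qed.

Lemma offspring_sigma_algebra_measurable v : F v `<=` measurable.
Proof.
apply: smallest_sub; first exact: sigma_algebra_measurable.
move=> _ [[k ->]|[k [i [B [ik mB ->]]]]]; first exact: measurable_offspring_eq.
apply: measurableI; first exact: measurable_offspring_eq.
by have := measurable_funP (X v i) measurableT _ mB; rewrite setTI.
Qed.

(** Off the event [i < K v w] the variable [X v i] need not be measurable for the offspring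
    sigma-algebra of [v], so it is replaced by 0. *)
Definition displacement v i w : R := if (i < K v w)%N then X v i w else 0.

Lemma joint_offspring_eq v k : measurable ([set w | K v w = k] : set (joint [set v])).
Proof.
apply: sub_sigma_algebra; exists v => //; apply: sub_sigma_algebra; left.
by exists k.
Qed.

Lemma measurable_displacement v i :
  measurable_fun (setT : set (joint [set v])) (displacement v i : joint [set v] -> R).
Proof.
move=> _ B mB; rewrite setTI.
rewrite [X in measurable X](_ : _ = \bigcup_k
    ([set w | K v w = k] `&` (displacement v i @^-1` B))).
  apply: bigcupT_measurable => k; have [ik|ki] := ltnP i k.
    rewrite [X in measurable X](_ : _ = [set w | K v w = k /\ B (X v i w)]).
      apply: sub_sigma_algebra; exists v => //; apply: sub_sigma_algebra; right.
      by exists k, i, B.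
    by apply/seteqP; split => w /= [Kk]; rewrite /displacement Kk ik.
  have [B0|B0] := pselect (B 0).
    rewrite [X in measurable X](_ : _ = [set w | K v w = k]).
      exact: joint_offspring_eq.
    by apply/seteqP; split => [w [] //|w /= Kk]; rewrite /displacement Kk ltnNge ki.
  rewrite [X in measurable X](_ : _ = set0) //.
  by apply/seteqP; split => // w /= [Kk]; rewrite /displacement Kk ltnNge ki.
by apply/seteqP; split => [w Bw|w [k _ []]] //; exists (K v w).
Qed.

(* The maximum, relative to [v], over the descendants of [v] that are [r]
   generations younger. *)
Fixpoint sub_max r v w : R :=
  if r is r'.+1 then
    \big[Num.max/displacement v 0 w + sub_max r' (rcons v 0%N) w]_(i < K v w)
      (displacement v i w + sub_max r' (rcons v i) w)
  else 0.

(** The starting value of the maximum is the entry of child 0, a genuine child because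
    [K v w > 0]. *)
Lemma sub_max_le r v w x : sub_max r.+1 v w <= x <->
  forall i, (i < K v w)%N -> displacement v i w + sub_max r (rcons v i) w <= x.
Proof.
have K0 := gbrw_offspring_gt0 gbrw v w; split=> /=.
  move=> h i iK; apply: le_trans h.
  exact: (le_bigmax _ (fun j : 'I_(K v w) =>
    displacement v j w + sub_max r (rcons v j) w) (Ordinal iK)).
by move=> h; apply: bigmax_le => [|i _]; apply: h.
Qed.

Definition descendants (v : seq nat) : set (seq nat) := [set l | prefix v l].

Lemma descendants_rcons v i : descendants (rcons v i) `<=` descendants v.
Proof. by move=> l; apply: prefix_trans; exact: prefix_rcons. Qed.

(** Measurability for the labels below [v] alone is what makes disjoint subtrees independent. *)
Lemma measurable_sub_max r v : measurable_fun (setT : set (joint (descendants v)))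
  (sub_max r v : joint (descendants v) -> R).
Proof.
elim: r v => [|r IH] v; first exact: measurable_cst.
pose h i w := displacement v i w + sub_max r (rcons v i) w.
have mh i : measurable_fun (setT : set (joint (descendants v))) (h i : joint (descendants v) -> R).
  apply: measurable_funD; last first.
    exact: measurable_joint_sub (@descendants_rcons v i) (IH (rcons v i)).
  have vd : [set v] `<=` descendants v by move=> _ ->; exact: prefix_refl.
  exact: measurable_joint_sub vd (@measurable_displacement v i).
apply: (@measurable_fun_cases _ (joint (descendants v)) (K v) _ _ _ _
  (fun k w => \big[Num.max/h 0%N w]_(i < k) h i w)) => // k.
  have vv : [set v] `<=` descendants v by move=> _ ->; exact: prefix_refl.
  exact: (@joint_sub _ _ _ F _ _ vv _ (@joint_offspring_eq v k)).
elim: (index_enum _) => [|j s IHs].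
  by under eq_fun do rewrite big_nil; exact: mh.
by under eq_fun do rewrite big_cons; apply: measurable_maxr.
Qed.

Lemma sub_max_measurable r v : measurable_fun setT (sub_max r v).
Proof.
exact: (@measurable_joint _ _ _ F (@offspring_sigma_algebra_measurable) _ _
  (descendants v) _ (@measurable_sub_max r v)).
Qed.

Lemma measurable_sub_max_le r v x : measurable [set w | sub_max r v w <= x].
Proof.
have := @sub_max_measurable r v measurableT _ (measurable_itv `]-oo, x]).
by rewrite setTI; congr measurable; apply/seteqP; split => w /=; rewrite in_itv.
Qed.

Definition sub_cdf r v x : R := fine (P [set w | sub_max r v w <= x]).

Lemma sub_cdf_bounds r v x : 0 <= sub_cdf r v x <= 1.
Proof.
rewrite fine_ge0 //= -lee_fin fineK; last by rewrite fin_num_measure //; exact: measurable_sub_max_le.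
by apply: probability_le1; exact: measurable_sub_max_le.
Qed.

Lemma sub_cdf_homo r v : {homo sub_cdf r v : x y / x <= y}.
Proof.
move=> x y xy; apply: fine_le; rewrite ?fin_num_measure //; try exact: measurable_sub_max_le.
apply: le_measure; rewrite ?inE; try exact: measurable_sub_max_le.
by move=> w /= /le_trans; exact.
Qed.

Lemma integral_le_sub_max r v x :
  (\int[P]_w ((sub_max r v w <= x)%R%:R)%:E = (sub_cdf r v x)%:E)%E.
Proof.
rewrite /sub_cdf fineK; last by rewrite fin_num_measure //; exact: measurable_sub_max_le.
rewrite -[in RHS](setIT [set w | sub_max r v w <= x]) -integral_indic //; last exact: measurable_sub_max_le.
by apply: eq_integral => w _; rewrite indicE mem_setE.
Qed.

(* The subtrees of the children of [v] are independent of each other and of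
   the offspring of [v]: they are integrated out one after the other. *)
Lemma integral_children r v k x :
  (\int[P]_w ((K v w == k)%:R * \prod_(i < k)
     (sub_max r (rcons v i) w <= x - displacement v i w)%R%:R)%:E =
   \int[P]_w ((K v w == k)%:R * \prod_(i < k)
     sub_cdf r (rcons v i) (x - displacement v i w))%:E)%E.
Proof.
(* Hybrid factors: the first [j] children are already integrated out. *)
pose g j i w : R := if (i < j)%N then sub_cdf r (rcons v i) (x - displacement v i w)
  else (sub_max r (rcons v i) w <= x - displacement v i w)%R%:R.
suff main j : (j <= k)%N ->
    (\int[P]_w ((K v w == k)%:R * \prod_(i < k) g 0%N i w)%:E =
     \int[P]_w ((K v w == k)%:R * \prod_(i < k) g j i w)%:E)%E.
  have := main k (leqnn k).
  have -> : (fun w => ((K v w == k)%:R * \prod_(i < k) g 0%N i w)%:E) =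
      (fun w => ((K v w == k)%:R * \prod_(i < k)
        (sub_max r (rcons v i) w <= x - displacement v i w)%R%:R)%:E) by [].
  move=> ->; apply: eq_integral => w _; congr (_ * _)%:E.
  by apply: eq_bigr => i _; rewrite /g ltn_ord.
elim: j => [//|j IH] jk; rewrite IH ?(ltnW jk) // {IH}.
pose j' := Ordinal jk.
(* Everything except the subtree of child [j]; it contains [v] and the subtrees of the siblings. *)
pose S := ~` descendants (rcons v j).
have vS : [set v] `<=` S.
  by move=> _ -> /prefixP[s] /(congr1 size); rewrite size_cat size_rcons; lia.
have dS i : i != j -> descendants (rcons v i) `<=` S.
  move=> ij l /prefixP[s1 ->] /prefixP[s2]; rewrite !cat_rcons => /eqP.
  by rewrite eqseq_cat // eqxx /= eqseq_cons (negbTE ij).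
have mdS i : measurable_fun (setT : set (joint S)) (displacement v i : joint S -> R).
  exact: measurable_joint_sub vS (@measurable_displacement v i).
have mg i : i != j -> measurable_fun (setT : set (joint S)) (g j i : joint S -> R).
  move=> ij; rewrite /g; case: (i < j)%N.
    apply: (measurableT_comp (f := sub_cdf r (rcons v i))).
      by apply: nondecreasing_measurable => //; exact: sub_cdf_homo.
    exact: measurable_funB.
  apply: measurable_fun_natr_bool; apply: measurable_fun_ler; last exact: measurable_funB.
  exact: measurable_joint_sub (@dS i ij) (@measurable_sub_max r (rcons v i)).
have g01 l i w : 0 <= g l i w.
  by rewrite /g; case: ifP => _; rewrite ?ler0n //; have /andP[] := @sub_cdf_bounds r (rcons v i) (x - displacement v i w).
pose h w : R := (K v w == k)%:R * \prod_(i < k | i != j') g j i w.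
have h_ge0 w : 0 <= h w by rewrite mulr_ge0 ?ler0n // prodr_ge0.
pose phi (z : Omega * R) : \bar R := (h z.1 * (z.2 <= x - displacement v j z.1)%R%:R)%:E.
have SC : S `&` descendants (rcons v j) = set0 by rewrite /S setICl.
have main := integral_independent offspring_sigma_algebraP
  (@offspring_sigma_algebra_measurable) (gbrw_independent gbrw) SC
  (@measurable_sub_max r (rcons v j)).
transitivity (\int[P]_w phi (w, sub_max r (rcons v j) w))%E.
  apply: eq_integral => w _; rewrite /phi /h /=. rewrite (bigD1 j') //=; congr (_%:E).
  by rewrite mulrCA [LHS]mulrC; congr (_ * _); rewrite /g ltnn.
rewrite (main phi); last 2 first.
- have mKk : measurable_fun (setT : set (joint S)) (fun w : joint S => (K v w == k)%:R : R).
    apply: measurable_fun_natr_bool; apply: (measurable_fun_bool true).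
    rewrite setTI [X in measurable X](_ : _ = [set w | K v w = k]).
      exact: (@joint_sub _ _ _ F _ _ vS _ (@joint_offspring_eq v k)).
    by apply/seteqP; split => w /= /eqP.
  have mh : measurable_fun (setT : set (joint S)) (h : joint S -> R).
    apply: measurable_funM => //.
    under eq_fun do rewrite -big_filter.
    apply: measurable_prod => i; rewrite mem_filter => /andP[ij _]; exact: mg.
  apply/measurable_EFinP; apply: measurable_funM.
    exact: measurableT_comp mh measurable_fst.
  apply: measurable_fun_natr_bool; apply: measurable_fun_ler; first exact: measurable_snd.
  apply: measurable_funB => //.
  exact: measurableT_comp (mdS j) measurable_fst.
- by move=> z; rewrite lee_fin mulr_ge0 // ler0n.
apply: eq_integral => w _; rewrite /phi /=.
under eq_integral do rewrite EFinM.
rewrite ge0_integralZl_EFin //; last first.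
  apply/measurable_EFinP; apply: measurable_fun_natr_bool.
  by apply: measurable_fun_ler => //; exact: sub_max_measurable.
rewrite integral_le_sub_max -EFinM /h [in RHS](bigD1 j') //= /g /= leqnn; congr (_%:E).
rewrite [RHS]mulrCA [LHS]mulrC; congr (_ * (_ * _)).
apply: eq_bigr => i ij.
have -> // : (i < j.+1)%N = (i < j)%N.
by rewrite ltnS leq_eqVlt -[(_ == _ :> nat)]/(i == j') (negbTE ij).
Qed.

End branching_process.

(** * The law of the offspring *)

Lemma integral_mrestr d (T : measurableType d) (R : realType)
    (mu : {measure set T -> \bar R}) (D : set T) (mD : measurable D) (f : T -> \bar R) :
  measurable_fun setT f -> (forall w, 0 <= f w)%E ->
  (\int[mrestr mu mD]_w f w = \int[mu]_(w in D) f w)%E.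
Proof.
move=> mf f0; rewrite (@ge0_negligible_integral _ _ _ _ setT (~` D)) //.
- rewrite setTD setCK; apply: eq_measure_integral => A mA AD.
  by change (mu (A `&` D) = mu A); rewrite setIidl.
- exact: measurableC.
- by change (mu (~` D `&` D) = 0%E); rewrite setICl measure0.
Qed.

Section offspring_law.
Set Implicit Arguments.
Unset Strict Implicit.
Context d (Omega : measurableType d) (R : realType) (P : probability Omega R).
Variables (p : nat -> nat -> R) (G : nat -> forall k, probability (k.-tuple R) R).
Variables (K : seq nat -> {RV P >-> nat}) (X : seq nat -> nat -> {RV P >-> R}).
Hypothesis gbrw : is_gbrw K X p G.

Let mK v k : measurable [set w | K v w = k].
Proof. exact: measurable_offspring_eq. Qed.

(** The defining law is given on lower boxes only; uniqueness of finite measures extends it to all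
    integrands. *)
Lemma integral_offspring_law v k (g : k.-tuple R -> \bar R) : (0 < k)%N ->
  measurable_fun setT g -> (forall t, 0 <= g t)%E ->
  (\int[P]_(w in [set w | K v w = k]) g [tuple X v i w | i < k] =
   (p (size v) k)%:E * \int[G (size v) k]_t g t)%E.
Proof.
move=> k_gt0 mg g0.
pose tup w := [tuple X v i w | i < k].
have mtup : measurable_fun setT tup.
  apply/measurable_fun_tnthP => i; rewrite (_ : _ \o _ = X v i) //.
  by apply/funext => w; rewrite /= tnth_mktuple.
pose tup' : {mfun Omega >-> k.-tuple R} := HB.pack tup (isMeasurableFun.Build _ _ _ _ _ mtup).
have p0 : 0 <= p (size v) k by have [h _ _] := gbrw_rules gbrw (size v); exact: h.
pose m1 := pushforward (mrestr P (mK v k)) tup'.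
pose m2 := mscale (NngNum p0) (G (size v) k).
have m12 A : measurable A -> m1 A = m2 A.
  apply: measure_lower_box_unique.
    change (P (tup @^-1` setT `&` [set w | K v w = k]) < +oo)%E.
    rewrite preimage_setT setTI.
    by rewrite ltey_eq fin_num_measure.
  move=> x; change (P (tup @^-1` lower_box k x `&` [set w | K v w = k]) =
    ((p (size v) k)%:E * G (size v) k (lower_box k x))%E).
  transitivity (P [set w | K v w = k /\ forall i : 'I_k, X v i w <= tnth x i]).
    congr (P _); apply/seteqP; split => w /=.
      by move=> [h ->]; split=> // i; have := h i; rewrite tnth_mktuple.
    by move=> [-> h]; split=> // i; rewrite tnth_mktuple.
  rewrite (gbrw_displacement_law gbrw) // (gbrw_offspring_law gbrw) //.
  by rewrite /joint_cdf fineK // fin_num_measure //; exact: measurable_lower_box.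
have <- : (\int[m2]_t g t = (p (size v) k)%:E * \int[G (size v) k]_t g t)%E.
  by rewrite /m2 ge0_integral_mscale.
have <- : (\int[m1]_t g t = \int[m2]_t g t)%E.
  by apply: eq_measure_integral => A mA _; exact: m12.
rewrite /m1 ge0_integral_pushforward // integral_mrestr //.
  exact: measurableT_comp.
by move=> w; exact: g0.
Qed.

Lemma integral_cases_eq v (f g : Omega -> \bar R) :
  measurable_fun setT f -> measurable_fun setT g ->
  (forall w, 0 <= f w)%E -> (forall w, 0 <= g w)%E ->
  (forall k, (0 < k)%N -> \int[P]_(w in [set w | K v w = k]) f w =
     \int[P]_(w in [set w | K v w = k]) g w)%E ->
  (\int[P]_w f w = \int[P]_w g w)%E.
Proof.
move=> mf mg f0 g0 fg; rewrite !(integral_cases _ _ _ P (K v) (mK v)) //.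
apply: eq_eseriesr => k _; have [->|/fg//] := posnP k.
have -> : [set w | K v w = 0%N] = set0.
  by apply/seteqP; split => // w /= Kw; have := gbrw_offspring_gt0 gbrw v w; rewrite Kw.
by rewrite !integral_set0.
Qed.

Lemma measurable_offspring_number v (h : nat -> R) :
  measurable_fun setT (fun w => h (K v w)).
Proof.
apply: (@measurable_fun_cases _ _ (K v) (mK v) _ _ _ (fun k _ => h k)) => //.
Qed.

Lemma measurable_offspring_sum v (h : nat -> Omega -> R) :
  (forall i, measurable_fun setT (h i)) ->
  measurable_fun setT (fun w => \sum_(i < K v w) h i w).
Proof.
move=> mh; apply: (@measurable_fun_cases _ _ (K v) (mK v) _ _ _
  (fun k w => \sum_(i < k) h i w)) => // k.
exact: measurable_sum.
Qed.

Lemma measurable_offspring_prod v (h : nat -> Omega -> R) :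
  (forall i, measurable_fun setT (h i)) ->
  measurable_fun setT (fun w => \prod_(i < K v w) h i w).
Proof.
move=> mh; apply: (@measurable_fun_cases _ _ (K v) (mK v) _ _ _
  (fun k w => \prod_(i < k) h i w)) => // k.
exact: measurable_prod.
Qed.

Section marginal.
Variables (mu : nat -> probability R R).
Hypothesis muP : forall n k (i : 'I_k) x,
  marginal_cdf (G n k) i x = fine (mu n [set y | y <= x]).

Lemma integral_tnth n k (i : 'I_k) (f : R -> R) : bounded_ge0 f ->
  (\int[G n k]_t (f (tnth t i))%:E = (mean (mu n) f)%:E)%E.
Proof.
move=> bf.
pose ti : {mfun k.-tuple R >-> R} := HB.pack (fun t : k.-tuple R => tnth t i)
  (isMeasurableFun.Build _ _ _ _ _ (measurable_tnth i)).
have mray x : measurable [set y : R | y <= x].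
  by rewrite [X in measurable X](_ : _ = `]-oo, x]%classic).
have E A : measurable A -> distribution (G n k) ti A = mu n A.
  apply: measure_rays_unique; first by rewrite ltey_eq fin_num_measure.
  move=> x; have := muP n i x; rewrite /marginal_cdf => h.
  rewrite -[RHS]fineK ?fin_num_measure // -h fineK // fin_num_measure //.
  by have := measurable_funP ti measurableT _ (mray x); rewrite setTI.
rewrite -integral_mean //.
have <- : (\int[distribution (G n k) ti]_y (f y)%:E = \int[mu n]_y (f y)%:E)%E.
  by apply: eq_measure_integral => A mA _; exact: E.
rewrite ge0_integral_pushforward //; first exact: measurable_EFin_bounded.
by move=> y _; rewrite lee_fin; exact: bounded_ge0_fun_ge0.
Qed.

Lemma integral_displacement v k i (f : R -> R) : (i < k)%N -> bounded_ge0 f ->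
  (\int[P]_(w in [set w | K v w = k]) (f (X v i w))%:E =
   P [set w | K v w = k] * (mean (mu (size v)) f)%:E)%E.
Proof.
move=> ik bf; have k_gt0 : (0 < k)%N by apply: leq_ltn_trans ik.
have := @integral_offspring_law v k (fun t => (f (tnth t (Ordinal ik)))%:E) k_gt0.
rewrite integral_tnth // -(gbrw_offspring_law gbrw) // => <-.
- by apply: eq_integral => w _; rewrite tnth_mktuple.
- apply/measurable_EFinP; apply: measurableT_comp; first by case: bf.
  exact: measurable_tnth.
- by move=> t; rewrite lee_fin; exact: bounded_ge0_fun_ge0.
Qed.

(** The marginal is the same for every family size, so the first displacement decouples from
    [K v]. *)
Lemma integral_first_displacement v (c : nat -> R) (f : R -> R) :
  (forall k, 0 <= c k) -> bounded_ge0 f ->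
  (\int[P]_w (c (K v w) * f (X v 0%N w))%:E =
   \int[P]_w (c (K v w))%:E * (mean (mu (size v)) f)%:E)%E.
Proof.
move=> c0 bf; have f0 := bounded_ge0_fun_ge0 f bf.
have m0 := mean_ge0 (mu (size v)) f bf.
have mc : measurable_fun setT (fun w => (c (K v w))%:E).
  by apply/measurable_EFinP; exact: measurable_offspring_number.
have mf : measurable_fun setT (fun w => (f (X v 0%N w))%:E).
  by apply/measurable_EFinP; apply: measurableT_comp => //; case: bf.
rewrite -ge0_integralZr // ; last by move=> w _; rewrite lee_fin.
apply: (@integral_cases_eq v).
- apply/measurable_EFinP; apply: measurable_funM; first exact: measurable_offspring_number.
  by apply: measurableT_comp => //; case: bf.
- exact: emeasurable_funM.
- by move=> w; rewrite lee_fin mulr_ge0.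
- by move=> w; rewrite mule_ge0 // lee_fin.
move=> k k_gt0.
transitivity (\int[P]_(w in [set w | K v w = k]) ((c k)%:E * (f (X v 0%N w))%:E))%E.
  by apply: eq_integral => w; rewrite inE /= => ->; rewrite EFinM.
rewrite ge0_integralZl_EFin //.
- rewrite integral_displacement //.
  transitivity (\int[P]_(w in [set w | K v w = k]) (cst ((c k)%:E * (mean (mu (size v)) f)%:E)) w)%E.
    by rewrite integral_cst // -muleA [X in (_ * X)%E]muleC muleA.
  by apply: eq_integral => w; rewrite inE /= => ->.
- by move=> w _; rewrite lee_fin.
- exact: measurable_funTS.
Qed.

Lemma integral_sum_displacements v (c : nat -> R) (f : R -> R) :
  (forall k, 0 <= c k) -> bounded_ge0 f ->
  (\int[P]_w (c (K v w) * \sum_(i < K v w) f (X v i w))%:E =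
   \int[P]_w (c (K v w) * (K v w)%:R)%:E * (mean (mu (size v)) f)%:E)%E.
Proof.
move=> c0 bf; have f0 := bounded_ge0_fun_ge0 f bf.
have m0 := mean_ge0 (mu (size v)) f bf.
have mc : measurable_fun setT (fun w => (c (K v w) * (K v w)%:R)%:E).
  by apply/measurable_EFinP; exact: (measurable_offspring_number v (fun k => c k * k%:R)).
have mf i : measurable_fun setT (fun w => f (X v i w)).
  by apply: measurableT_comp => //; case: bf.
rewrite -ge0_integralZr //; last by move=> w _; rewrite lee_fin mulr_ge0.
apply: (@integral_cases_eq v).
- apply/measurable_EFinP; apply: measurable_funM; first exact: measurable_offspring_number.
  exact: (@measurable_offspring_sum v (fun i w => f (X v i w))).
- exact: emeasurable_funM.
- by move=> w; rewrite lee_fin mulr_ge0 // sumr_ge0.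
- by move=> w; rewrite mule_ge0 // lee_fin mulr_ge0.
move=> k k_gt0.
transitivity (\int[P]_(w in [set w | K v w = k])
    ((c k)%:E * \sum_(i < k) (f (X v i w))%:E))%E.
  by apply: eq_integral => w; rewrite inE /= => ->; rewrite EFinM sumEFin.
rewrite ge0_integralZl_EFin //; last 2 first.
- by move=> w _; rewrite sumEFin lee_fin sumr_ge0.
- apply: measurable_funTS; under eq_fun do rewrite sumEFin.
  by apply/measurable_EFinP; exact: measurable_sum.
rewrite ge0_integral_sum //; last 2 first.
- by move=> i; apply: measurable_funTS; apply/measurable_EFinP; exact: mf.
- by move=> i w _; rewrite lee_fin.
have [q pE] : exists q : R, P [set w | K v w = k] = q%:E.
  by exists (fine (P [set w | K v w = k])); rewrite fineK // fin_num_measure.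
under eq_bigr => i _ do rewrite integral_displacement // pE -EFinM.
rewrite sumEFin sumr_const card_ord.
transitivity (\int[P]_(w in [set w | K v w = k])
    (cst ((c k * k%:R)%:E * (mean (mu (size v)) f)%:E)) w)%E.
  rewrite integral_cst // [X in _ = (_ * X)%E](_ : _ = q%:E) // -!EFinM; congr (_%:E).
  by rewrite -[_ *+ k]mulr_natl; ring.
by apply: eq_integral => w; rewrite inE /= => ->.
Qed.

End marginal.

End offspring_law.

(** * The recursion for the tails *)

Lemma prod_natr_bool {R : realType} k (b : nat -> bool) :
  \prod_(i < k) (b i)%:R = [forall i : 'I_k, b i]%:R :> R.
Proof.
case: forallP => [h|/forallP]; first by rewrite big1 // => i _; rewrite h.
rewrite negb_forall => /existsP[i /negbTE bi].
by rewrite (bigD1 i) //= bi mul0r.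
Qed.

Section recursion.
Set Implicit Arguments.
Unset Strict Implicit.
Context d (Omega : measurableType d) (R : realType) (P : probability Omega R).
Variables (p : nat -> nat -> R) (G : nat -> forall k, probability (k.-tuple R) R).
Variables (K : seq nat -> {RV P >-> nat}) (X : seq nat -> nat -> {RV P >-> R}).
Hypothesis gbrw : is_gbrw K X p G.

Let mK v k : measurable [set w | K v w = k].
Proof. exact: measurable_offspring_eq. Qed.

Let cdf := sub_cdf K X.
Let smax := sub_max K X.
Let disp := displacement K X.

Let cdf01 r v x : 0 <= cdf r v x <= 1.
Proof. exact: sub_cdf_bounds. Qed.

Let measurable_cdf r v : measurable_fun setT (cdf r v).
Proof.
apply: nondecreasing_measurable => //.
exact: sub_cdf_homo.
Qed.

Let measurable_cdf_X r v u i x : measurable_fun setT (fun w => cdf r v (x - X u i w)).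
Proof. by apply: (measurableT_comp (measurable_cdf r v)); exact: measurable_funB. Qed.

Lemma integral_on_eq v k (f : Omega -> R) :
  (\int[P]_(w in [set w | K v w = k]) (f w)%:E =
   \int[P]_w ((K v w == k)%:R * f w)%:E)%E.
Proof.
rewrite integral_mkcond; apply: eq_integral => w _; rewrite patchE.
case: ifPn; rewrite ?inE ?notin_setE /=; first by move=> ->; rewrite eqxx mul1r.
by move=> /eqP/negbTE ->; rewrite mul0r.
Qed.

(** On [K v w = k] the event factors over the children, [integral_children] replaces each subtree by
    its distribution function, and [displacement] agrees with [X]. *)
Lemma sub_cdf_rec r v x : ((cdf r.+1 v x)%:E =
  \int[P]_w (\prod_(i < K v w) cdf r (rcons v i) (x - X v i w))%:E)%E.
Proof.
rewrite -integral_le_sub_max.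
apply: (integral_cases_eq gbrw (v := v)).
- apply/measurable_EFinP; apply: measurable_fun_natr_bool.
  apply: (measurable_fun_bool true); rewrite setTI.
  exact: measurable_sub_max_le.
- apply/measurable_EFinP.
  exact: (@measurable_offspring_prod _ _ _ P K v (fun i w => cdf r (rcons v i) (x - X v i w))).
- by move=> w; rewrite lee_fin.
- by move=> w; rewrite lee_fin prodr_ge0 // => i _; have /andP[] := cdf01 r (rcons v i) (x - X v i w).
move=> k k_gt0; rewrite !integral_on_eq.
transitivity (\int[P]_w ((K v w == k)%:R * \prod_(i < k)
     (smax r (rcons v i) w <= x - disp v i w)%R%:R)%:E)%E.
  apply: eq_integral => w _; case: eqP => [Kk|_]; last by rewrite !mul0r.
  rewrite !mul1r (prod_natr_bool k (fun i => smax r (rcons v i) w <= x - disp v i w)).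
  congr ((nat_of_bool _)%:R%:E); apply/idP/forallP => [h i|h].
    have := (sub_max_le gbrw r v w x).1 h i.
    by rewrite Kk ltn_ord => /(_ isT); rewrite lerBrDl.
  apply/(sub_max_le gbrw r v w x) => i; rewrite Kk => ik.
  by have := h (Ordinal ik); rewrite lerBrDl.
rewrite (integral_children gbrw).
apply: eq_integral => w _; case: eqP => [Kk|_]; last by rewrite !mul0r.
rewrite Kk !mul1r; congr (_%:E); apply: eq_bigr => i _.
by rewrite /displacement Kk ltn_ord.
Qed.

(** By induction all children of [v] and [v'] share one distribution function, and both sides become
    the same series in [p] and [G] at that generation. *)
Lemma sub_cdf_size r v v' : size v = size v' -> cdf r v = cdf r v'.
Proof.
elim: r v v' => [//|r IH] v v' vv'; apply/funext => x; apply: EFin_inj.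
rewrite !sub_cdf_rec.
pose c := cdf r (rcons v 0%N).
have cE i : cdf r (rcons v i) = c by apply: IH; rewrite !size_rcons.
have cE' i : cdf r (rcons v' i) = c by apply: IH; rewrite !size_rcons vv'.
have main u : (forall i, cdf r (rcons u i) = c) -> size u = size v ->
    (\int[P]_w (\prod_(i < K u w) cdf r (rcons u i) (x - X u i w))%:E =
     \sum_(1 <= k <oo) ((p (size v) k)%:E *
       \int[G (size v) k]_t (\prod_(i < k) c (x - tnth t i))%:E))%E.
  move=> uE us; rewrite (integral_cases _ _ _ P (K u) (mK u)); last 2 first.
  - apply/measurable_EFinP.
    exact: (@measurable_offspring_prod _ _ _ P K u (fun i w => cdf r (rcons u i) (x - X u i w))).
  - by move=> w; rewrite lee_fin prodr_ge0 // => i _; have /andP[] := cdf01 r (rcons u i) (x - X u i w).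
  rewrite nneseries_recl //; last first.
    move=> k _; apply: integral_ge0 => w _.
    by rewrite lee_fin prodr_ge0 // => i _; have /andP[] := cdf01 r (rcons u i) (x - X u i w).
  have -> : [set w | K u w = 0%N] = set0.
    by apply/seteqP; split => // w /= Kw; have := gbrw_offspring_gt0 gbrw u w; rewrite Kw.
  rewrite integral_set0 add0e eseries_cond [RHS]eseries_cond.
  apply: eq_eseriesr => k /= k_gt0; rewrite -us.
  rewrite -(integral_offspring_law gbrw u (k := k)
    (g := fun t => (\prod_(i < k) c (x - tnth t i))%:E)) //.
  - apply: eq_integral => w; rewrite inE /= => ->; congr (_%:E).
    by apply: eq_bigr => i _; rewrite uE tnth_mktuple.
  - apply/measurable_EFinP; apply: measurable_prod => i _.
    apply: (measurableT_comp (measurable_cdf r (rcons v 0%N))).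
    by apply: measurable_funB => //; exact: measurable_tnth.
  - by move=> t; rewrite lee_fin prodr_ge0 // => i _; have /andP[] := cdf01 r (rcons v 0%N) (x - tnth t i).
by rewrite (main v cE) // (main v' cE').
Qed.

(** The label of zeros represents its generation, which is legitimate by [sub_cdf_size]. *)
Definition max_tail s r x : R := 1 - cdf r (nseq s 0%N) x.

Lemma max_tail_fun s r : tail_fun (max_tail s r).
Proof.
split=> [x y xy|x].
  by rewrite lerD2l lerN2; exact: sub_cdf_homo.
by have := cdf01 r (nseq s 0%N) x; rewrite /max_tail; lra.
Qed.

Lemma max_tail0 s x : max_tail s 0 x = (x < 0)%R%:R.
Proof.
rewrite /max_tail /cdf /sub_cdf /=; have [x0|x0] := ltP x 0.
  rewrite [X in P X](_ : _ = set0) ?measure0 ?subr0 //.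
  by apply/seteqP; split => // w /=; rewrite leNgt x0.
rewrite [X in P X](_ : _ = setT) ?probability_setT ?subrr //.
by apply/seteqP; split.
Qed.

Lemma max_tail_rec s r x : ((max_tail s r.+1 x)%:E =
  \int[P]_w (at_least_one (K (nseq s 0%N) w)
    (fun i => max_tail s.+1 r (x - X (nseq s 0%N) i w)))%:E)%E.
Proof.
set v := nseq s 0%N.
have E w : at_least_one (K v w) (fun i => max_tail s.+1 r (x - X v i w)) =
    1 - \prod_(i < K v w) cdf r (rcons v i) (x - X v i w).
  congr (1 - _); apply: eq_bigr => i _; rewrite /max_tail subKr.
  by rewrite (@sub_cdf_size r _ (rcons v i)) // size_rcons !size_nseq.
have P01 w : 0 <= \prod_(i < K v w) cdf r (rcons v i) (x - X v i w) <= 1.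
  apply/andP; split.
    by apply: prodr_ge0 => i _; have /andP[] := cdf01 r (rcons v i) (x - X v i w).
  by apply: prodr_ile1 => i _; exact: cdf01.
have mprod : measurable_fun setT (fun w => \prod_(i < K v w) cdf r (rcons v i) (x - X v i w)).
  exact: (@measurable_offspring_prod _ _ _ P K v (fun i w => cdf r (rcons v i) (x - X v i w))).
have h2 := sub_cdf_rec r v x.
have -> : (\int[P]_w (at_least_one (K v w) (fun i => max_tail s.+1 r (x - X v i w)))%:E =
    \int[P]_w (1 - \prod_(i < K v w) cdf r (rcons v i) (x - X v i w))%:E)%E.
  by apply: eq_integral => w _; rewrite E.
have h1 : (\int[P]_w (1 - \prod_(i < K v w) cdf r (rcons v i) (x - X v i w))%:E +
    \int[P]_w (\prod_(i < K v w) cdf r (rcons v i) (x - X v i w))%:E = 1)%E.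
  rewrite -ge0_integralD //.
  - under eq_integral do rewrite -EFinD subrK.
    by rewrite integral_cst //= probability_setT mule1.
  - by move=> w _; rewrite lee_fin; have := P01 w; lra.
  - by apply/measurable_EFinP; apply: measurable_funB.
  - by move=> w _; rewrite lee_fin; have /andP[] := P01 w.
  - exact/measurable_EFinP.
move: h1; rewrite -h2 /max_tail -/v EFinB => <-.
by rewrite addeK.
Qed.

Variables (mu : nat -> probability R R) (m1 : R).
Hypothesis muP : forall n k (i : 'I_k) x,
  marginal_cdf (G n k) i x = fine (mu n [set y | y <= x]).
Hypothesis second_moment : forall n,
  (\sum_(1 <= k <oo) ((k%:R ^+ 2) * p n k)%:E <= m1%:E)%E.

Lemma integral_offspring_number v (c : nat -> R) : (forall k, 0 <= c k) ->
  (\int[P]_w (c (K v w))%:E = \sum_(1 <= k <oo) (c k * p (size v) k)%:E)%E.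
Proof.
move=> c0; rewrite (integral_cases _ _ _ P (K v) (mK v)); last 2 first.
- by apply/measurable_EFinP; exact: (@measurable_offspring_number _ _ _ P K v).
- by move=> w; rewrite lee_fin.
rewrite nneseries_recl //; last first.
  by move=> k _; apply: integral_ge0 => w _; rewrite lee_fin.
have -> : [set w | K v w = 0%N] = set0.
  by apply/seteqP; split => // w /= Kw; have := gbrw_offspring_gt0 gbrw v w; rewrite Kw.
rewrite integral_set0 add0e eseries_cond [RHS]eseries_cond.
apply: eq_eseriesr => k /= k_gt0.
transitivity (\int[P]_(w in [set w | K v w = k]) (cst (c k)%:E) w)%E.
  by apply: eq_integral => w; rewrite inE /= => ->.
rewrite integral_cst // EFinM; congr (_ * _)%E.
exact: (gbrw_offspring_law gbrw).
Qed.

Definition mean_offspring s : R := fine (\sum_(1 <= k <oo) (k%:R * p s k)%:E)%E.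

Lemma mean_offspringE s :
  ((mean_offspring s)%:E = \sum_(1 <= k <oo) (k%:R * p s k)%:E)%E.
Proof.
have [p0 _ fin] := gbrw_rules gbrw s; rewrite /mean_offspring fineK //.
rewrite ge0_fin_numE // ; apply: nneseries_ge0 => k k0 _.
by rewrite lee_fin mulr_ge0 // p0.
Qed.

Lemma max_tail_branching_step s r :
  branching_step (mu s) (mean_offspring s) m1 (max_tail s r.+1) (max_tail s.+1 r).
Proof.
move=> A1 A2 C x1 x2 k0 f0 f1 f2 f3 A1_ge0 A2_ge0 C_ge0 k0_gt0 b0 b1 b2 b3 ptw.
pose v := nseq s 0%N; have sv : size v = s by rewrite size_nseq.
pose alo x w := at_least_one (K v w) (fun i => max_tail s.+1 r (x - X v i w)).
have v01 y : 0 <= max_tail s.+1 r y <= 1 by exact: (max_tail_fun s.+1 r).2.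
have alo_ge0 x w : 0 <= alo x w by have /andP[] := @at_least_one_bounds R (K v w) _ (fun i => v01 (x - X v i w)).
have mtail i x : measurable_fun setT (fun w => max_tail s.+1 r (x - X v i w)).
  by apply: measurable_funB => //; exact: measurable_cdf_X.
have malo x : measurable_fun setT (alo x).
  apply: measurable_funB => //.
  apply: (@measurable_offspring_prod _ _ _ P K v (fun i w => 1 - max_tail s.+1 r (x - X v i w))) => i.
  exact: measurable_funB.
have mfX f i : bounded_ge0 f -> measurable_fun setT (fun w => f (X v i w)).
  by move=> [mf _]; exact: measurableT_comp.
have msum f : bounded_ge0 f -> measurable_fun setT (fun w => \sum_(i < K v w) f (X v i w)).
  by move=> bf; apply: (@measurable_offspring_sum _ _ _ P K v (fun i w => f (X v i w))) => i; exact: mfX.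
have mKh (h : nat -> R) : measurable_fun setT (fun w => h (K v w)).
  exact: (@measurable_offspring_number _ _ _ P K v).
have sum_ge0 f w : bounded_ge0 f -> 0 <= \sum_(i < K v w) f (X v i w).
  by move=> bf; apply: sumr_ge0 => i _; exact: bounded_ge0_fun_ge0.
have iD (f g : Omega -> R) : measurable_fun setT f -> measurable_fun setT g ->
    (forall w, 0 <= f w) -> (forall w, 0 <= g w) ->
    (\int[P]_w (f w + g w)%:E = \int[P]_w (f w)%:E + \int[P]_w (g w)%:E)%E.
  move=> mf mg f_ge0 g_ge0; under eq_integral do rewrite EFinD.
  rewrite ge0_integralD //; try (by move=> w _; rewrite lee_fin);
  exact/measurable_EFinP.
have iZ c (f : Omega -> R) : 0 <= c -> measurable_fun setT f ->
    (forall w, 0 <= f w) -> (\int[P]_w (c * f w)%:E = c%:E * \int[P]_w (f w)%:E)%E.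
  move=> c_ge0 mf f_ge0; under eq_integral do rewrite EFinM.
  rewrite ge0_integralZl_EFin //; first by move=> w _; rewrite lee_fin.
  exact/measurable_EFinP.
have EK : (\int[P]_w (1 * (K v w)%:R)%:E = (mean_offspring s)%:E)%E.
  rewrite mean_offspringE; under eq_integral do rewrite mul1r.
  by rewrite (@integral_offspring_number v (fun k => k%:R)) // sv.
have [s2 EK2 s2_le] : exists2 s2 : R,
    (\int[P]_w ((K v w)%:R * (K v w)%:R)%:E = s2%:E)%E & s2 <= m1.
  have E : (\int[P]_w ((K v w)%:R * (K v w)%:R)%:E =
      \sum_(1 <= k <oo) (k%:R ^+ 2 * p s k)%:E)%E.
    rewrite -[in RHS]sv; apply: (@integral_offspring_number v (fun k => k%:R * k%:R)).
    by move=> k; rewrite mulr_ge0.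
  have E0 : (0 <= \int[P]_w ((K v w)%:R * (K v w)%:R)%:E)%E.
    by apply: integral_ge0 => w _; rewrite lee_fin mulr_ge0.
  have Em := second_moment s; rewrite -E in Em.
  exists (fine (\int[P]_w ((K v w)%:R * (K v w)%:R)%:E)%E).
    by rewrite fineK // ge0_fin_numE // (le_lt_trans Em) // ltry.
  by rewrite -lee_fin fineK // ge0_fin_numE // (le_lt_trans Em) // ltry.
have k0R : 0 < k0%:R :> R by rewrite ltr0n.
(* Markov: a family larger than [k0] satisfies [K ^ 2 >= k0]. *)
have [r0 Er0 r0_ge] : exists2 r0 : R,
    (\int[P]_w ((K v w <= k0)%N%:R)%:E = r0%:E)%E & 1 - m1 / k0%:R <= r0.
  have E0 : (0 <= \int[P]_w ((K v w <= k0)%N%:R)%:E)%E.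
    by apply: integral_ge0 => w _; rewrite lee_fin.
  have E1 : (\int[P]_w ((K v w <= k0)%N%:R)%:E <= 1)%E.
    rewrite -[leRHS](@probability_setT _ _ _ P) -[leRHS]mul1e -integral_cst //.
    apply: ge0_le_integral => //.
    - by apply/measurable_EFinP; exact: (mKh (fun k => (k <= k0)%N%:R)).
    - by move=> w _; rewrite lee_fin; case: (_ <= _)%N.
  have Efin : (\int[P]_w ((K v w <= k0)%N%:R)%:E)%E \is a fin_num.
    by rewrite ge0_fin_numE // (le_lt_trans E1) // ltry.
  exists (fine (\int[P]_w ((K v w <= k0)%N%:R)%:E)%E); first by rewrite fineK.
  suff : (1 <= \int[P]_w ((K v w <= k0)%N%:R)%:E + (m1 / k0%:R)%:E)%E.
    by rewrite -{1}(fineK Efin) -EFinD lee_fin; lra.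
  apply: (@le_trans _ _ (\int[P]_w ((K v w <= k0)%N%:R +
      k0%:R^-1 * ((K v w)%:R * (K v w)%:R))%:E)%E).
    rewrite -[leLHS](@probability_setT _ _ _ P) -[leLHS]mul1e -integral_cst //.
    apply: ge0_le_integral => //.
    - apply/measurable_EFinP.
      exact: (mKh (fun k => (k <= k0)%N%:R + k0%:R^-1 * (k%:R * k%:R))).
    - move=> w _; rewrite lee_fin; case: leqP => Kk.
        by rewrite lerDl !mulr_ge0 ?invr_ge0 ?ler0n.
      rewrite add0r ler_pdivlMl // mulr1 -natrM ler_nat; nia.
  rewrite iD //; last 2 first.
  - exact: (mKh (fun k => (k <= k0)%N%:R)).
  - exact: (mKh (fun k => k0%:R^-1 * (k%:R * k%:R))).
  rewrite leeD2l // iZ ?invr_ge0 ?ler0n //; last exact: (mKh (fun k => k%:R * k%:R)).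
  by rewrite EK2 -EFinM lee_fin mulrC ler_pM2r // invr_gt0.
have If0 : (\int[P]_w ((K v w <= k0)%N%:R * f0 (X v 0%N w))%:E = (r0 * mean (mu s) f0)%:E)%E.
  by rewrite (integral_first_displacement gbrw muP v (c := fun k => (k <= k0)%N%:R)) // Er0 sv.
have Isum f : bounded_ge0 f ->
    (\int[P]_w (\sum_(i < K v w) f (X v i w))%:E = (mean_offspring s * mean (mu s) f)%:E)%E.
  move=> bf; have := integral_sum_displacements gbrw muP v (c := fun=> 1) (fun=> ler01) bf.
  by under eq_integral do rewrite mul1r; rewrite EK sv => ->.
have Isum2 : (\int[P]_w ((K v w)%:R * \sum_(i < K v w) f2 (X v i w))%:E = (s2 * mean (mu s) f2)%:E)%E.
  by rewrite (integral_sum_displacements gbrw muP v (c := fun k => k%:R)) // EK2 sv.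
have f_ge0 := bounded_ge0_fun_ge0.
have mf0 : measurable_fun setT (fun w => (K v w <= k0)%N%:R * f0 (X v 0%N w)).
  by apply: measurable_funM; [exact: (mKh (fun k => (k <= k0)%N%:R))|exact: mfX].
have mf2 : measurable_fun setT (fun w => (K v w)%:R * \sum_(i < K v w) f2 (X v i w)).
  by apply: measurable_funM; [exact: (mKh (fun k => k%:R))|exact: msum].
have f0_ge0 w : 0 <= (K v w <= k0)%N%:R * f0 (X v 0%N w) by rewrite mulr_ge0 // f_ge0.
have f2_ge0 w : 0 <= (K v w)%:R * \sum_(i < K v w) f2 (X v i w) by rewrite mulr_ge0 // sum_ge0.
have ma A x : measurable_fun setT (fun w => A * alo x w) by exact: measurable_funM.
have L : (\int[P]_w (A1 * alo x1 w + (K v w <= k0)%N%:R * f0 (X v 0%N w) +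
    \sum_(i < K v w) f3 (X v i w))%:E =
    (A1 * max_tail s r.+1 x1 + r0 * mean (mu s) f0 + mean_offspring s * mean (mu s) f3)%:E)%E.
  rewrite iD //; last 4 first.
  - exact: measurable_funD.
  - exact: msum.
  - by move=> w; rewrite addr_ge0 // mulr_ge0.
  - by move=> w; exact: sum_ge0.
  rewrite iD //; last by move=> w; rewrite mulr_ge0.
  by rewrite iZ // -max_tail_rec If0 Isum // -EFinM -!EFinD.
have Rt : (\int[P]_w (A2 * alo x2 w + C + \sum_(i < K v w) f1 (X v i w) +
    (K v w)%:R * \sum_(i < K v w) f2 (X v i w))%:E =
    (A2 * max_tail s r.+1 x2 + C + mean_offspring s * mean (mu s) f1 + s2 * mean (mu s) f2)%:E)%E.
  have a2 w : 0 <= A2 * alo x2 w by rewrite mulr_ge0.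
  rewrite iD //; last 2 first.
  - by apply: measurable_funD; [exact: measurable_funD|exact: msum].
  - by move=> w; rewrite addr_ge0 ?sum_ge0 // addr_ge0.
  rewrite iD //; last 4 first.
  - exact: measurable_funD.
  - exact: msum.
  - by move=> w; rewrite addr_ge0.
  - by move=> w; exact: sum_ge0.
  rewrite iD // iZ // -max_tail_rec Isum2 Isum // integral_cst //= probability_setT mule1.
  by rewrite -EFinM -!EFinD.
have main : (A1 * max_tail s r.+1 x1 + r0 * mean (mu s) f0 + mean_offspring s * mean (mu s) f3 <=
    A2 * max_tail s r.+1 x2 + C + mean_offspring s * mean (mu s) f1 + s2 * mean (mu s) f2).
  rewrite -lee_fin -L -Rt; apply: ge0_le_integral => //.
  - by move=> w _; rewrite lee_fin addr_ge0 ?sum_ge0 // addr_ge0 // mulr_ge0.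
  - by apply/measurable_EFinP; apply: measurable_funD; [exact: measurable_funD|exact: msum].
  - apply/measurable_EFinP; apply: measurable_funD => //.
    by apply: measurable_funD; [exact: measurable_funD|exact: msum].
  - move=> w _; rewrite lee_fin; apply: (ptw (K v w) (fun i => X v i w)).
    exact: (gbrw_offspring_gt0 gbrw).
have h0 : (1 - m1 / k0%:R) * mean (mu s) f0 <= r0 * mean (mu s) f0.
  by rewrite ler_wpM2r // mean_ge0.
have h2 : s2 * mean (mu s) f2 <= m1 * mean (mu s) f2.
  by rewrite ler_wpM2r // mean_ge0.
lra.
Qed.

End recursion.

(** * Tightness *)

Section max_position.
Context d (Omega : measurableType d) (R : realType) (P : probability Omega R).
Variables (p : nat -> nat -> R) (G : nat -> forall k, probability (k.-tuple R) R).
Variables (K : seq nat -> {RV P >-> nat}) (X : seq nat -> nat -> {RV P >-> R}).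
Hypothesis gbrw : is_gbrw K X p G.
Set Implicit Arguments.
Unset Strict Implicit.

(* [alive] and [location] with the root moved to [v]. *)
Definition alive_from v l w :=
  forall j, (j < size l)%N -> (nth 0%N l j < K (v ++ take j l) w)%N.

Definition location_from v l w : R :=
  \sum_(j < size l) X (v ++ take j l) (nth 0%N l j) w.

Lemma alive_from_cons v i l w : alive_from v (i :: l) w <->
  (i < K v w)%N /\ alive_from (rcons v i) l w.
Proof.
split=> [h|[iK h] [|j] /= jl]; last 2 first.
- by rewrite cats0.
- by rewrite -cat_rcons; exact: h.
by split=> [|j jl]; [have := h 0%N isT; rewrite /= cats0|have := h j.+1 jl; rewrite /= -cat_rcons].
Qed.

Lemma location_from_cons v i l w :
  location_from v (i :: l) w = X v i w + location_from (rcons v i) l w.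
Proof.
rewrite /location_from /= big_ord_recl /= cats0; congr (_ + _).
by apply: eq_bigr => j _; rewrite /bump /= -cat_rcons.
Qed.

Lemma location_from_le l v w : alive_from v l w ->
  location_from v l w <= sub_max K X (size l) v w.
Proof.
elim: l v => [|i l IH] v; first by rewrite /location_from big_ord0.
move=> /alive_from_cons[iK al]; rewrite location_from_cons.
apply: le_trans ((sub_max_le gbrw (size l) v w _).1 (lexx _) i iK).
by rewrite /displacement iK lerD2l IH.
Qed.

(** Follow a maximizing child in each generation. Attainment identifies the supremum in
    [max_position] with [sub_max]. *)
Lemma location_from_attained r v w : exists l,
  [/\ size l = r, alive_from v l w & location_from v l w = sub_max K X r v w].
Proof.
elim: r v => [|r IH] v; first by exists [::]; split; rewrite ?/location_from ?big_ord0.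
have [i iK iE] : exists2 i, (i < K v w)%N &
    displacement K X v i w + sub_max K X r (rcons v i) w = sub_max K X r.+1 v w.
  have [//|h] := pselect (exists2 i, (i < K v w)%N &
    displacement K X v i w + sub_max K X r (rcons v i) w = sub_max K X r.+1 v w).
  have lt i : (i < K v w)%N ->
      displacement K X v i w + sub_max K X r (rcons v i) w < sub_max K X r.+1 v w.
    move=> iK; rewrite lt_neqAle ((sub_max_le gbrw r v w _).1 (lexx _)) // andbT.
    by apply/eqP => E; apply: h; exists i.
  have : sub_max K X r.+1 v w < sub_max K X r.+1 v w.
    rewrite {1}/sub_max -/(sub_max K X r); apply: bigmax_lt => [|i _]; apply: lt => //.
    exact: (gbrw_offspring_gt0 gbrw).
  by rewrite ltxx.
have [l [ls al lE]] := IH (rcons v i).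
exists (i :: l); split; first by rewrite /= ls.
  exact/alive_from_cons.
by rewrite location_from_cons lE -iE /displacement iK.
Qed.

Lemma max_positionE n w : max_position K X n w = sub_max K X n [::] w.
Proof.
have ub : ubound [set location X v w | v in alive K n w] (sub_max K X n [::] w).
  by move=> _ [l [<- al] <-]; exact: (@location_from_le l [::] w al).
have mem : [set location X v w | v in alive K n w] (sub_max K X n [::] w).
  have [l [ls al lE]] := location_from_attained n [::] w.
  by exists l => //; split => // j; rewrite -ls; exact: al.
apply/eqP; rewrite eq_le; apply/andP; split.
  by apply: ge_sup => //; exists (sub_max K X n [::] w).
by apply: ub_le_sup => //; exists (sub_max K X n [::] w).
Qed.

End max_position.

Section max_tail_limits.
Context d (Omega : measurableType d) (R : realType) (P : probability Omega R).
Variables (K : seq nat -> {RV P >-> nat}) (X : seq nat -> nat -> {RV P >-> R}).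
Variable n : nat.

Let M : {RV P >-> R} := HB.pack (sub_max K X n [::])
  (isMeasurableFun.Build _ _ _ _ _ (@sub_max_measurable _ _ _ _ K X n [::])).

Let cdfE x : (cdf M x = (1 - max_tail K X 0 n x)%:E)%E.
Proof.
rewrite /max_tail subKr /sub_cdf fineK; last first.
  by rewrite fin_num_measure //; exact: measurable_sub_max_le.
by congr (P _); apply/seteqP; split => w /=; rewrite in_itv.
Qed.

(** With [max_tail_large], this makes the set in [median] nonempty and bounded below, so its infimum
    is genuine. *)
Lemma max_tail_small : exists x, max_tail K X 0 n x <= 2^-1.
Proof.
have [//|h] := pselect (exists x, max_tail K X 0 n x <= 2^-1).
have : (1%:E <= (2^-1)%:E :> \bar R)%E.
  apply: (cvge_to_le (@cvg_cdfy1 _ _ _ P M)); apply: nearW => x.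
  rewrite cdfE lee_fin; have := contra_not (ex_intro _ x) h.
  by move=> /negP; rewrite -ltNge; lra.
by rewrite lee_fin; lra.
Qed.

Lemma max_tail_large : exists x, 2^-1 < max_tail K X 0 n x.
Proof.
have [//|h] := pselect (exists x, 2^-1 < max_tail K X 0 n x).
have : ((2^-1)%:E <= 0%:E :> \bar R)%E.
  apply: (cvge_to_ge (@cvg_cdfNy0 _ _ _ P M)); apply: nearW => x.
  rewrite cdfE lee_fin; have := contra_not (ex_intro _ x) h.
  by move=> /negP; rewrite -leNgt; lra.
by rewrite lee_fin; lra.
Qed.

End max_tail_limits.

Section median.
Context {R : realType}.
Variables (u : R -> R).
Hypothesis tu : tail_fun u.
Hypothesis u_small : exists x, u x <= 2^-1.
Hypothesis u_large : exists x, 2^-1 < u x.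

Let med := median (fun x => 1 - u x).

Let S : set R := [set x | 2^-1 <= 1 - u x].

Let S_lb : exists x, lbound S x.
Proof.
have [x ux] := u_large; exists x => y; rewrite /S /= => yS.
by rewrite leNgt; apply/negP => /ltW/tu.1; lra.
Qed.

(** Strictness provides a point of the defining set below [x]; monotonicity does the rest. *)
Lemma tail_right_median x : med < x -> u x <= 2^-1.
Proof.
have S0 : S !=set0 by have [x0 h] := u_small; exists x0; rewrite /S /=; lra.
move=> /(inf_lt S0)[y yS yx]; have := tu.1 _ _ (ltW yx).
by move: yS; rewrite /S /=; lra.
Qed.

Lemma tail_left_median x : x < med -> 2^-1 <= u x.
Proof.
move=> xm; rewrite leNgt; apply/negP => ux.
have : med <= x by apply: ge_inf; [exact: S_lb|rewrite /S /=; lra].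
by rewrite leNgt xm.
Qed.

End median.

Theorem theorem2 (R : realType) (d : measure_display)
    (Omega : measurableType d) (P : probability Omega R)
    (p : nat -> nat -> R)
    (G : nat -> forall k : nat, probability (k.-tuple R) R)
    (g : nat -> nat -> R -> R) (gs : nat -> R -> R)
    (K : seq nat -> {RV P >-> nat}) (X : seq nat -> nat -> {RV P >-> R})
    (m0 m1 eps0 x0 : R)
    (gbrw : is_gbrw K X p G)
    (marginals : forall (n k : nat) (i : 'I_k) (x : R),
       marginal_cdf (G n k) i x = g n k x)
    (m0_gt0 : 0 < m0) (m1_gt0 : 0 < m1)
    (B1_inf : (m0%:E < ereal_inf
       (range (fun n : nat => \sum_(1 <= k <oo) (k%:R * p n k)%:E)))%E)
    (B1_gt1 : 1 < m0)
    (B1_sup : (ereal_sup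
       (range (fun n : nat => \sum_(1 <= k <oo) ((k%:R ^+ 2) * p n k)%:E))
         < m1%:E)%E)
    (MT0 : forall (n k : nat) (x : R), (0 < k)%N -> g n k x = gs n x)
    (MT1_eps0 : eps0 < Num.min (ln m0 / 4) 1)
    (MT1 : forall n : nat, 1 - eps0 <= 1 - gs n x0)
    (MT2 : exists a M0 : R, [/\ 0 < a, 0 < M0 &
       forall (n : nat) (M x : R), M0 < M -> 0 <= x ->
         1 - gs n (x + M) <= expR (- (a * M)) * (1 - gs n x)])
    (GT : forall eta1 : R, 0 < eta1 -> exists B : R, 0 < B /\
       forall n k : nat, (0 < k)%N ->
         1 - eta1 <= joint_cdf (G n k) [tuple B | _ < k] /\
         1 - eta1 <= 1 - gs n (- B)) :
  tight (fun n : nat => pushforward P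
    (fun w : Omega => max_position K X n w - median (max_cdf K X n))).
Proof.
pose tnth0 : {mfun 1.-tuple R >-> R} := HB.pack (fun t : 1.-tuple R => tnth t ord0)
  (isMeasurableFun.Build _ _ _ _ _ (measurable_tnth ord0)).
(* A measure with distribution function [gs n] is read off from families with one child. *)
pose mu n : probability R R := distribution (G n 1) tnth0.
have mray x : measurable [set y : R | y <= x].
  by rewrite [X in measurable X](_ : _ = `]-oo, x]%classic).
have mu_cdf n x : fine (mu n [set y | y <= x]) = gs n x.
  by rewrite -(MT0 n 1) // -(marginals n 1 ord0).
have muP n k (i : 'I_k) x : marginal_cdf (G n k) i x = fine (mu n [set y | y <= x]).
  by rewrite marginals MT0 ?mu_cdf //; apply: leq_ltn_trans (ltn_ord i).
have tailE n x : upper_tail (mu n) x = 1 - gs n x.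
  rewrite -mu_cdf /upper_tail.
  have -> : `]x, +oo[%classic = ~` [set y : R | y <= x].
    by apply/seteqP; split => y /=; rewrite in_itv /= andbT ltNge => /negP.
  by rewrite probability_setC // fineB // fin_num_measure.
have second n : (\sum_(1 <= k <oo) ((k%:R ^+ 2) * p n k)%:E <= m1%:E)%E.
  by apply: le_trans (ltW B1_sup); apply: ereal_sup_ubound; exists n.
have p_ge0 n k : (0 < k)%N -> 0 <= p n k by have [h _ _] := gbrw_rules gbrw n; exact: h.
have m_ge n : m0 <= mean_offspring p n.
  rewrite -lee_fin (mean_offspringE gbrw); apply: (le_trans (ltW B1_inf)).
  by apply: ereal_inf_lbound; exists n.
have m_le n : mean_offspring p n <= m1.
  rewrite -lee_fin (mean_offspringE gbrw); apply: le_trans (second n).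
  rewrite eseries_cond [leRHS]eseries_cond; apply: lee_nneseries => k.
    by move=> _ /= k0; rewrite lee_fin mulr_ge0 // p_ge0.
  move=> /= k0; rewrite lee_fin ler_wpM2r ?p_ge0 // expr2 ler_peMl //.
  by rewrite (ler_nat R 1).
have [a [M0 [a_gt0 M0_gt0 tail]]] := MT2.
have right n t M : M0 < M -> 0 <= t ->
    upper_tail (mu n) (t + M) <= expR (- (a * M)) * upper_tail (mu n) t.
  by rewrite !tailE; exact: tail.
have left eta : 0 < eta -> exists2 B : R, 0 < B & forall n, 1 - eta <= upper_tail (mu n) (- B).
  by move=> /GT[B [B0 h]]; exists B => // n; rewrite tailE; case: (h n 1 isT).
have spread := uniform_spread mu (mean_offspring p) m0 m1 a M0 (max_tail K X)
  B1_gt1 m_ge m_le a_gt0 M0_gt0 right left (max_tail_fun K X) (max_tail0 K X)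
  (max_tail_branching_step gbrw muP second).
(* Each side of the segment gets mass at most [e / 2]; [la < 1/2] puts [1 - la] strictly above the
   level of the median. *)
move=> e e_gt0; pose la := Num.min (e / 2) 4^-1.
have la_gt0 : 0 < la by rewrite lt_min; apply/andP; split; lra.
have la_e : la <= e / 2 by rewrite ge_min lexx.
have la_4 : la <= 4^-1 by rewrite ge_min lexx orbT.
have la_2 : la <= 2^-1 by lra.
have [L hL] := spread la la_gt0 la_2.
(* The sign of [L] is unspecified, and the summand 2 leaves room for the strict inequalities around
   the median. *)
pose L' := `|L| + 2.
exists `[- L', L']%classic; split; first exact: segment_compact.
move=> n; pose u := max_tail K X 0 n.
have tu : tail_fun u := max_tail_fun K X 0 n.
have cdfE : max_cdf K X n = fun x => 1 - u x.
  apply/funext => x; rewrite /max_cdf /u /max_tail subKr; congr (fine (P _)).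
  by apply/seteqP; split => w /=; rewrite (max_positionE gbrw).
rewrite cdfE; set med := median _.
have LL : L <= `|L| by exact: ler_norm.
have high : u (med + L') <= la.
  (* Otherwise the tail would be at least [1 - la > 1/2] at a point still to the right of the
     median. *)
  rewrite leNgt; apply/negP => /ltW/hL hu.
  have : u (med + L' - L) <= 2^-1.
    by apply: (tail_right_median tu (max_tail_small K X n)); rewrite /L' -/med; lra.
  by rewrite -/u in hu; lra.
have low : 1 - la <= u (med - L').
  apply: (@le_trans _ _ (u (med - 1 - L))); last by apply: tu.1; rewrite /L'; lra.
  apply: hL; apply: (@le_trans _ _ 2^-1); first by lra.
  by apply: (tail_left_median tu (max_tail_large K X n)); rewrite -/med; lra.
pose below x := [set w | sub_max K X n [::] w <= x].
have mle x : measurable (below x) by exact: measurable_sub_max_le.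
have PE x : P (below x) = (1 - u x)%:E.
  by rewrite /u /max_tail subKr /sub_cdf fineK //; exact: (fin_num_measure P _ (mle x)).
apply: (@le_trans _ _ (P (~` below (med + L') `|` below (med - L')))).
  rewrite /pushforward; apply: le_measure; rewrite ?inE.
  - have mM : measurable_fun setT (fun w => max_position K X n w - med).
      under eq_fun do rewrite (max_positionE gbrw).
      by apply: measurable_funB => //; exact: sub_max_measurable.
    have := mM measurableT _ (measurableC (measurable_itv `[- L', L'])).
    by rewrite setTI.
  - by apply: measurableU => //; exact: measurableC.
  move=> w /=; rewrite in_itv /= (max_positionE gbrw) => /negP.
  rewrite negb_and -!ltNge => /orP[h|h]; [right|left]; rewrite /below /=; first by lra.
  by apply/negP; rewrite -ltNge; lra.
have PC : P (~` below (med + L')) = (u (med + L'))%:E.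
  by rewrite probability_setC // PE -EFinB; congr (_%:E); ring.
apply: (@le_trans _ _ (P (~` below (med + L')%R) + P (below (med - L')%R))%E).
  by apply: measureU2 => //; exact: measurableC.
by rewrite PC PE -EFinD lee_fin; lra.
Qed.
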